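(* Let $X=(S,J)$ be a closed Riemann surface of genus at least $2$ with canonical bundle $K$, let $q_0\neq 0$ be a holomorphic quartic differential on $X$ and $q_s=sq_0$, $s>0$. Let $\sigma$ be the conformal hyperbolic metric on $X$ and let $g_s=\mathrm{diag}(g_{1,s},g_{2,s}^{-1},g_{1,s}^{-1},g_{2,s})$ be the harmonic metric on the Higgs bundle $(\mathcal{E},\varphi_s)$ over $X$, where $$\mathcal{E}=K^{\frac32}\oplus K^{-\frac12}\oplus K^{-\frac32}\oplus K^{\frac12},\qquad \varphi_s=\begin{pmatrix}0&0&q_s&0\\0&0&0&1\\0&1&0&0\\1&0&0&0\end{pmatrix}.$$ Let $p\in X$ be a zero of order $k\ge1$ of $q_0$. Then there exists a family of radii $r_s\to0$ such that, as $s\to+\infty$, $$g_{1,s}^{-1}\big|_{B(p,r_s)}=O\big(s^{\frac{3}{k+4}}\sigma^{\frac32}\big)\qquad\text{and}\qquad g_{2,s}^{-1}\big|_{B(p,r_s)}=O\big(s^{\frac{1}{k+4}}\sigma^{\frac12}\big).$$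
   Context: A square root $K^{1/2}$ is fixed. The harmonic metric is the solution $g$ of Hitchin's self-duality equation $F_g+[\varphi_s,\varphi_s^{*g}]=0$, $F_g$ being the curvature of the Chern connection of $g$; it is unique and diagonal of the form displayed. Thus $g_{1,s}$ is a Hermitian metric on $K^{3/2}$ and $g_{2,s}$ one on $K^{1/2}$, and $g_{1,s}^{-1}$, $g_{2,s}^{-1}$ are compared with the powers $\sigma^{3/2},\sigma^{1/2}$ of $\sigma=\sigma(z)|dz|^2$ (same transformation type in local coordinates). $B(p,r)$ is the ball of radius $r$ centered at $p$. $A_s|_{B(p,r_s)}=O(B_s)$ means that there are constants $C,s_0>0$ with $A_s\le CB_s$ on $B(p,r_s)$ for all $s\ge s_0$. *)

(* Defs.v *)
From HB Require Import structures.
From mathcomp Require Import all_boot all_order all_algebra.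
From mathcomp Require Import complex.
From mathcomp Require Import all_classical all_reals all_analysis.

Set Implicit Arguments.
Unset Strict Implicit.
Unset Printing Implicit Defensive.

Import Order.TTheory GRing.Theory Num.Theory numFieldNormedType.Exports.
Local Open Scope classical_set_scope.
Local Open Scope ring_scope.
Local Open Scope complex_scope.
Local Open Scope sesquilinear_scope.

(* The usual topology of R[i], and R[i] as a normed space over itself: with
   these, [derivable f z 1] is complex differentiability at z and [derive1 f z]
   is the complex derivative. *)
HB.instance Definition _ (R : realType) := NormedModule.copy R[i] R[i]^o.

Section Calculus.
Variable R : realType.

Definition unit_disc : set R[i] := [set z | `|z| < 1].

Definition holomorphic_on (D : set R[i]) (f : R[i] -> R[i]) : Prop :=
  forall z, D z -> derivable f z 1.

Definition slice_x (f : R[i] -> R) (z : R[i]) (t : R) : R := f (z + t%:C).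
Definition slice_y (f : R[i] -> R) (z : R[i]) (t : R) : R := f (z + (0 +i* t)).

Definition dx (f : R[i] -> R) (z : R[i]) : R := derive1 (slice_x f z) 0.
Definition dy (f : R[i] -> R) (z : R[i]) : R := derive1 (slice_y f z) 0.

Definition laplacian (f : R[i] -> R) (z : R[i]) : R := dx (dx f) z + dy (dy f) z.

(* Meant for open D. *)
Fixpoint class_C (n : nat) (D : set R[i]) (f : R[i] -> R) : Prop :=
  (forall z, D z -> {for z, continuous f}) /\
  match n with
  | 0%N => True
  | m.+1 =>
      [/\ forall z, D z -> derivable (slice_x f z) 0 1,
          forall z, D z -> derivable (slice_y f z) 0 1,
          class_C m D (dx f) & class_C m D (dy f)]
  end.

Definition smooth_on (D : set R[i]) (f : R[i] -> R) : Prop :=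
  forall n, class_C n D f.

Definition csmooth_on (D : set R[i]) (f : R[i] -> R[i]) : Prop :=
  smooth_on D (@complex.Re R \o f) /\ smooth_on D (@complex.Im R \o f).

Definition cdx (f : R[i] -> R[i]) (z : R[i]) : R[i] :=
  dx (@complex.Re R \o f) z +i* dx (@complex.Im R \o f) z.
Definition cdy (f : R[i] -> R[i]) (z : R[i]) : R[i] :=
  dy (@complex.Re R \o f) z +i* dy (@complex.Im R \o f) z.

Definition d_z (f : R[i] -> R[i]) (z : R[i]) : R[i] :=
  (cdx f z - 'i * cdy f z) / 2.
Definition d_zbar (f : R[i] -> R[i]) (z : R[i]) : R[i] :=
  (cdx f z + 'i * cdy f z) / 2.

Definition mx_d_z n (F : R[i] -> 'M[R[i]]_n) (z : R[i]) : 'M[R[i]]_n :=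
  \matrix_(i, j) d_z (fun w => F w i j) z.
Definition mx_d_zbar n (F : R[i] -> 'M[R[i]]_n) (z : R[i]) : 'M[R[i]]_n :=
  \matrix_(i, j) d_zbar (fun w => F w i j) z.

End Calculus.

(* A Riemann surface, presented by a holomorphic atlas of coordinate discs:
   [crd a] is the coordinate z_a on the chart domain [dom a] and [par a] its
   inverse, defined on the unit disc; values of [crd a] off [dom a] and of
   [par a] off the disc carry no meaning.  Every Riemann surface has such an
   atlas.  Taking the charts simply connected is what allows every square root
   of K to be given by a cocycle relative to this same atlas, see [sqrt_K]. *)
Record riemann_surface (R : realType) := RiemannSurface {
  rs_space :> topologicalType ;
  chart : Type ;
  dom : chart -> set rs_space ;
  crd : chart -> rs_space -> R[i] ;
  par : chart -> R[i] -> rs_space ;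
  dom_open : forall a, open (dom a) ;
  dom_cover : forall x : rs_space, exists a, dom a x ;
  crd_disc : forall a x, dom a x -> unit_disc (crd a x) ;
  par_dom : forall a z, unit_disc z -> dom a (par a z) ;
  crdK : forall a x, dom a x -> par a (crd a x) = x ;
  parK : forall a z, unit_disc z -> crd a (par a z) = z ;
  crd_continuous : forall a, {within dom a, continuous (crd a)} ;
  par_continuous : forall a, {within @unit_disc R, continuous (par a)} ;
  trans_holomorphic : forall a b,
    holomorphic_on [set z | unit_disc z /\ dom b (par a z)]
                   (fun z => crd b (par a z)) }.

Section Surface.
Variables (R : realType) (X : riemann_surface R).

Definition closed_surface : Prop :=
  [/\ compact [set: X], connected [set: X] & hausdorff_space X].

(* The genus of a closed surface is the maximal number of pairwise disjoint
   simple closed curves whose union does not disconnect it. *)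
Definition genus_at_least (n : nat) : Prop :=
  exists c : 'I_n -> R -> X,
    [/\ forall i, {within `[0, 1], continuous (c i)},
        forall i, c i 0 = c i 1,
        forall i, {in `[0, 1[ &, injective (c i)},
        forall i j, i != j -> (c i @` `[0, 1]) `&` (c j @` `[0, 1]) = set0 &
        connected (~` \bigcup_(i in [set: 'I_n]) (c i @` `[0, 1]))].

Definition overlap (a b : chart X) : set R[i] :=
  [set z | unit_disc z /\ dom b (par a z)].
Definition trans (a b : chart X) (z : R[i]) : R[i] := crd b (par a z).
Definition jac (a b : chart X) (z : R[i]) : R[i] := derive1 (trans a b) z.

(* Coordinate expressions, one function on the unit disc for each chart:
   [f a] is to be read in the coordinate z_a. *)
Definition local_fun (T : Type) := chart X -> R[i] -> T.

(* Holomorphic sections q_a(z_a) dz_a^n of K^n. *)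
Definition holomorphic_differential (n : nat) (q : local_fun R[i]) : Prop :=
  (forall a, holomorphic_on (@unit_disc R) (q a)) /\
  (forall a b z, overlap a b z ->
     q a z = q b (trans a b z) * jac a b z ^+ n).

Definition nonzero_section (q : local_fun R[i]) : Prop :=
  exists a z, unit_disc z /\ q a z != 0.

Definition zero_of_order (q : local_fun R[i]) (p : X) (k : nat) : Prop :=
  exists a, dom a p /\ exists h : R[i] -> R[i],
    h (crd a p) != 0 /\
    \forall z \near crd a p,
      derivable h z 1 /\ q a z = (z - crd a p) ^+ k * h z.

(* sigma_a(z_a) |dz_a|^2 *)
Definition conformal_metric (sigma : local_fun R) : Prop :=
  [/\ forall a, smooth_on (@unit_disc R) (sigma a),
      forall a z, unit_disc z -> 0 < sigma a z &
      forall a b z, overlap a b z ->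
        (sigma a z)%:C = (sigma b (trans a b z))%:C * `|jac a b z| ^+ 2].

Definition gauss_curvature (sigma : local_fun R) (a : chart X) (z : R[i]) : R :=
  - laplacian (fun w => ln (sigma a w)) z / (2 * sigma a z).

Definition hyperbolic_metric (sigma : local_fun R) : Prop :=
  conformal_metric sigma /\
  (forall a z, unit_disc z -> gauss_curvature sigma a z = -1).

(* [c] is the expression in the chart [a] of a C^1 arc on [0,1] from x to y, of
   length l.  Requiring c to be C^1 on all of R is harmless: a C^1 arc on [0,1]
   extends. *)
Definition chart_arc (sigma : local_fun R) (x y : X) (l : R) : Prop :=
  exists (a : chart X) (c : R -> R[i]),
    let u := @complex.Re R \o c in let v := @complex.Im R \o c in
    [/\ (forall t, derivable u t 1 /\ derivable v t 1) /\
          (continuous (derive1 u) /\ continuous (derive1 v)),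
        forall t, 0 <= t <= 1 -> unit_disc (c t),
        x = par a (c 0) /\ y = par a (c 1) &
        l = Rintegral lebesgue_measure `[0, 1]
              (fun t => Num.sqrt (sigma a (c t)) *
                        Num.sqrt (derive1 u t ^+ 2 + derive1 v t ^+ 2))].

Inductive piecewise_path (sigma : local_fun R) : X -> X -> R -> Prop :=
| path_nil x : piecewise_path sigma x x 0
| path_cons x y z l m :
    chart_arc sigma x y l -> piecewise_path sigma y z m ->
    piecewise_path sigma x z (l + m).

Definition metric_dist (sigma : local_fun R) (x y : X) : \bar R :=
  ereal_inf [set l%:E | l in piecewise_path sigma x y].

Definition metric_ball (sigma : local_fun R) (p : X) (r : R) : set X :=
  [set x | (metric_dist sigma p x < r%:E)%E].

(* A holomorphic square root L of K: [sq a b] is the ratio of the frames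
   sqrt(dz_b) / sqrt(dz_a) of L, where sqrt(dz_a) is a frame over [dom a] with
   square dz_a. *)
Record sqrt_K := SqrtK {
  sq : chart X -> chart X -> R[i] -> R[i] ;
  sq_holomorphic : forall a b, holomorphic_on (overlap a b) (sq a b) ;
  sq_square : forall a b z, overlap a b z -> sq a b z ^+ 2 = jac a b z ;
  sq_cocycle : forall a b c z, overlap a b z -> overlap a c z ->
    sq a c z = sq a b z * sq b c (trans a b z) }.

Variable L : sqrt_K.

(* Hermitian metrics on L^m = K^(m/2); [h a] is the squared norm of the frame
   sqrt(dz_a)^m. *)
Definition hermitian_metric_Kpow (m : int) (h : local_fun R) : Prop :=
  [/\ forall a, smooth_on (@unit_disc R) (h a),
      forall a z, unit_disc z -> 0 < h a z &
      forall a b z, overlap a b z ->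
        (h b (trans a b z))%:C = (h a z)%:C * `|(sq L a b z ^ m)%R| ^+ 2].

(* E = L^3 + L^-1 + L^-3 + L, in the frames sqrt(dz_a)^(3, -1, -3, 1). *)
Definition E_weight (j : 'I_4) : int := nth 0 [:: 3; -1; -3; 1] j.

Definition E_frame_change (a b : chart X) (z : R[i]) : 'M[R[i]]_4 :=
  diag_mx (\row_j (sq L a b z ^ E_weight j)%R).

(* [H a z i j] is the inner product of the j-th frame vector with the i-th one,
   so that <u, v> = v^* H u on column vectors. *)
Definition hermitian_metric_E (H : local_fun 'M[R[i]]_4) : Prop :=
  [/\ forall a i j, csmooth_on (@unit_disc R) (fun z => H a z i j),
      forall a z, unit_disc z -> (H a z) ^t* = H a z,
      forall a z, unit_disc z -> forall v : 'cV[R[i]]_4, v != 0 ->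
        0 < (v ^t* *m H a z *m v) 0 0 &
      forall a b z, overlap a b z ->
        H b (trans a b z) =
        (E_frame_change a b z) ^t* *m H a z *m E_frame_change a b z].

(* The Higgs field is higgs_mx (q_a) dz_a in the chart a. *)
Definition higgs_mx (q : R[i]) : 'M[R[i]]_4 :=
  \matrix_(i < 4, j < 4)
    nth 0 (nth [::] [:: [:: 0; 0; q; 0];
                        [:: 0; 0; 0; 1];
                        [:: 0; 1; 0; 0];
                        [:: 1; 0; 0; 0]] i) j.

(* Coefficient of dz /\ dzbar in the curvature dbar(H^-1 d H) of the Chern
   connection. *)
Definition chern_curvature (H : local_fun 'M[R[i]]_4) (a : chart X) (z : R[i])
    : 'M[R[i]]_4 :=
  - mx_d_zbar (fun w => invmx (H a w) *m mx_d_z (H a) w) z.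

(* Phi^{*H}, the coefficient of dzbar in the H-adjoint of Phi dz. *)
Definition mx_adjoint (H Phi : 'M[R[i]]_4) : 'M[R[i]]_4 :=
  invmx H *m Phi ^t* *m H.

Definition mx_commutator (A B : 'M[R[i]]_4) : 'M[R[i]]_4 := A *m B - B *m A.

(* F_H + [phi, phi^{*H}] = 0, as the equation of coefficients of dz /\ dzbar. *)
Definition hitchin_equation (q : local_fun R[i]) (H : local_fun 'M[R[i]]_4)
    : Prop :=
  forall a z, unit_disc z ->
    chern_curvature H a z +
    mx_commutator (higgs_mx (q a z)) (mx_adjoint (H a z) (higgs_mx (q a z))) = 0.

Definition harmonic_metric (q : local_fun R[i]) (H : local_fun 'M[R[i]]_4)
    : Prop :=
  hermitian_metric_E H /\ hitchin_equation q H.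

Definition diag_metric (g1 g2 : local_fun R) : local_fun 'M[R[i]]_4 :=
  fun a z => diag_mx (\row_(j < 4)
    nth 0 [:: (g1 a z)%:C; ((g2 a z)^-1)%:C; ((g1 a z)^-1)%:C; (g2 a z)%:C] j).

(* A_s = O(B_s) on the balls B(p, r_s) of the metric sigma as s -> +oo, for
   families A, B of coordinate expressions with the same transformation type. *)
Definition bigO_on_balls (sigma : local_fun R) (p : X) (r : R -> R)
    (A B : R -> local_fun R) : Prop :=
  exists C s0 : R, [/\ 0 < C, 0 < s0 &
    forall s, s0 <= s -> forall a z, unit_disc z ->
      metric_ball sigma p (r s) (par a z) -> A s a z <= C * B s a z].

End Surface.

(* Main.v *)
(** Fix a coordinate disc at [p] and put [u = - ln g1], [v = - ln g2].  The
    self-duality equation becomes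
      Delta u / 4 = e^(u - v) - |q|^2 e^(-2u),
      Delta v / 4 = e^(2v) - e^(u - v).
    The Poincare density [e^w = rho / (rho^2 - |z|^2)] of the disc of radius
    [rho] solves [Delta w / 4 = e^(2w)] and blows up at the boundary, so
    [u - 3w] and [v - w] attain their maxima in the interior.  Comparing
    Laplacians there, the exponentials [a], [b] of the two maxima satisfy
      a / b <= 3 + K / a^2   and   b^2 <= a / b + 1,   K = sup |q|^2 rho^8,
    which bounds both in terms of [K].  As [q = s q0] vanishes to order [k], the
    choice [rho = rho0 s^(-1/(k+4))] makes [K] independent of [s], and on the
    disc of radius [rho / 2] this gives [e^u = O(rho^-3)], [e^v = O(rho^-1)].
    The argument is purely local: each coordinate disc contains a metric ball,
    and the radii [r_s] may be taken as small as needed. *)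
Require Import Defs.
From HB Require Import structures.
From mathcomp Require Import all_boot all_order all_algebra.
From mathcomp Require Import complex.
From mathcomp Require Import all_classical all_reals all_analysis.
From mathcomp Require Import ring lra.
Set Implicit Arguments.
Unset Strict Implicit.
Import Order.TTheory GRing.Theory Num.Theory numFieldNormedType.Exports.
Local Open Scope classical_set_scope.
Local Open Scope ring_scope.
Local Open Scope complex_scope.

(** * Topology of the complex plane *)

Section ComplexPlane.
Variable R : realType.
Implicit Types z w : R[i].

(* The norm of [R[i]] is [R[i]]-valued; [nsq z] is |z|^2 as an element of [R]. *)
Definition nsq z : R := complex.Re z ^+ 2 + complex.Im z ^+ 2.

Lemma nsq_norm z : (nsq z)%:C = `|z| ^+ 2.
Proof. exact: add_Re2_Im2. Qed.

Lemma nsq_ge0 z : 0 <= nsq z.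
Proof. by rewrite addr_ge0 ?sqr_ge0. Qed.

Lemma nsqM z w : nsq (z * w) = nsq z * nsq w.
Proof. by case: z w => a b [c d]; rewrite /nsq /=; ring. Qed.

Lemma nsqX z n : nsq (z ^+ n) = nsq z ^+ n.
Proof.
elim: n => [|n IH]; first by rewrite /nsq /= expr0n /= addr0 expr1n.
by rewrite !exprS nsqM IH.
Qed.

Lemma nsq_real (x : R) : nsq x%:C = x ^+ 2.
Proof. by rewrite /nsq /= expr0n /= addr0. Qed.

Lemma ReB z w : complex.Re (z - w) = complex.Re z - complex.Re w.
Proof. by case: z w => a b []. Qed.

Lemma ImB z w : complex.Im (z - w) = complex.Im z - complex.Im w.
Proof. by case: z w => a b []. Qed.

Lemma Re_realM (x : R) z : complex.Re (x%:C * z) = x * complex.Re z.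
Proof. by case: z => a b; rewrite /= mul0r subr0. Qed.

Lemma Im_realM (x : R) z : complex.Im (x%:C * z) = x * complex.Im z.
Proof. by case: z => a b; rewrite /= mul0r addr0. Qed.

Lemma norm_Re_le z : `|complex.Re z|%:C <= `|z|.
Proof. exact: normc_ge_Re. Qed.

Lemma norm_Im_le z : `|complex.Im z|%:C <= `|z|.
Proof.
by rewrite normc_def lecR -sqrtr_sqr ler_wsqrtr// ?lerDr ?sqr_ge0.
Qed.

Lemma norm_le_ReIm z : `|z| <= (`|complex.Re z| + `|complex.Im z|)%:C.
Proof.
have im : `|'i%C * (complex.Im z)%:C : R[i]| = `|complex.Im z|%:C.
  have -> : 'i%C * (complex.Im z)%:C = 0 +i* complex.Im z by simpc.
  by rewrite normc_def /= expr0n /= add0r sqrtr_sqr.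
have re : `|(complex.Re z)%:C : R[i]| = `|complex.Re z|%:C.
  by rewrite normc_def /= expr0n /= addr0 sqrtr_sqr.
by rewrite rmorphD /= -im -re {1}(complexE z) ler_normD.
Qed.

Lemma pos_complexP (e : R[i]) : 0 < e -> exists2 x : R, 0 < x & e = x%:C.
Proof.
case: e => a b; rewrite ltcE /= => /andP[/eqP -> a0].
by exists a.
Qed.

Lemma cvg_Re_Im (T : Type) (F : set_system T) (FF : Filter F) (f : T -> R[i])
    (l : R[i]) :
  complex.Re (f x) @[x --> F] --> complex.Re l ->
  complex.Im (f x) @[x --> F] --> complex.Im l ->
  f x @[x --> F] --> l.
Proof.
move=> /cvgrPdist_lt fR /cvgrPdist_lt fI; apply/cvgrPdist_lt => _ /pos_complexP[e e0 ->].
have e2 : 0 < e / 2 by rewrite divr_gt0.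
near=> x; apply: (le_lt_trans (norm_le_ReIm _)).
rewrite ltcR ReB ImB (splitr e) ltrD//.
  by near: x; exact: fR.
by near: x; exact: fI.
Unshelve. all: by end_near. Qed.

Lemma continuous_Re : continuous (@complex.Re R).
Proof.
move=> z; apply/(@cvgrPdist_lt _ _ _ (nbhs z)) => e e0.
have ec : 0 < e%:C :> R[i] by rewrite ltcR.
have := nbhsx_ballx z _ ec; apply: filterS => w; rewrite -ball_normE /= -ReB => zw.
by rewrite -ltcR (le_lt_trans (norm_Re_le _)).
Qed.

Lemma continuous_Im : continuous (@complex.Im R).
Proof.
move=> z; apply/(@cvgrPdist_lt _ _ _ (nbhs z)) => e e0.
have ec : 0 < e%:C :> R[i] by rewrite ltcR.
have := nbhsx_ballx z _ ec; apply: filterS => w; rewrite -ball_normE /= -ImB => zw.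
by rewrite -ltcR (le_lt_trans (norm_Im_le _)).
Qed.

Lemma continuous_nsq : continuous nsq.
Proof.
move=> z; apply: (@cvgD _ _ _ (nbhs z)).
  apply: (@cvg_comp _ _ _ (@complex.Re R) (fun x => x ^+ 2)).
    exact: continuous_Re.
  exact: exprn_continuous.
apply: (@cvg_comp _ _ _ (@complex.Im R) (fun x => x ^+ 2)).
  exact: continuous_Im.
exact: exprn_continuous.
Qed.

Lemma nbhs_nsqP z (P : set R[i]) : nbhs z P ->
  exists2 d : R, 0 < d & forall w, nsq (w - z) <= d ^+ 2 -> P w.
Proof.
move=> /nbhs_ballP[e /pos_complexP[d d0 ->{e}] zP].
exists (d / 2); first by lra.
move=> w wd; apply: zP; rewrite -ball_normE /= distrC normc_def ltcR.
apply: (@le_lt_trans _ _ (d / 2)); last by lra.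
have d2 : 0 <= d / 2 by lra.
by rewrite -[leRHS](ger0_norm d2) -sqrtr_sqr ler_wsqrtr.
Qed.

Lemma unit_discE z : unit_disc z <-> nsq z < 1.
Proof.
by rewrite /unit_disc /= -(@ltcR _ (nsq z)) nsq_norm rmorph1 expr_lt1.
Qed.

Lemma unit_disc_open : open (@unit_disc R).
Proof.
have -> : @unit_disc R = nsq @^-1` [set x | x < 1].
  by apply/seteqP; split => z /unit_discE.
apply: open_comp => [z _|]; first exact: continuous_nsq.
exact: open_lt.
Qed.

Lemma unit_disc_nbhs z : unit_disc z -> \forall w \near z, unit_disc w.
Proof. by move=> zD; apply: open_nbhs_nbhs; split => //; exact: unit_disc_open. Qed.

Lemma continuous_complex : continuous (fun x : R * R => x.1 +i* x.2).
Proof.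
by move=> x; apply: cvg_Re_Im => /=; [exact: cvg_fst|exact: cvg_snd].
Qed.

(** The disc is closed and lies in the image of a product of two segments under the continuous map
    [(x, y) |-> x + iy]. The sign of [d] is free, hence the absolute values. *)
Lemma closed_disc_compact z (d : R) : compact [set w | nsq (w - z) <= d ^+ 2].
Proof.
pose I (x : R) := `[x - `|d|, x + `|d|]%classic.
pose Q := (fun x : R * R => x.1 +i* x.2) @` (I (complex.Re z) `*` I (complex.Im z)).
have Qc : compact Q.
  apply: continuous_compact; last by apply: compact_setX; exact: segment_compact.
  by apply: continuous_subspaceT; exact: continuous_complex.
apply: (subclosed_compact _ Qc).
  apply: (@preimage_closed _ _ (fun w => nsq (w - z)) [set x | x <= d ^+ 2]) => [w _|].
    apply: (@cvg_comp _ _ _ (fun w => w - z) nsq); last exact: continuous_nsq.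
    by apply: (@cvgB _ _ _ (nbhs w)); [exact: cvg_id|exact: cvg_cst].
  exact: closed_le.
move=> w /= wd; exists (complex.Re w, complex.Im w); last by case: w {wd}.
have sq_le (x y : R) : x ^+ 2 + y ^+ 2 <= d ^+ 2 -> `|x| <= `|d|.
  move=> h; rewrite -ler_sqr ?nnegrE// !real_normK ?num_real//.
  by rewrite (le_trans _ h)// lerDl sqr_ge0.
split; rewrite /I /= in_itv /= -ler_distl.
  by apply: (sq_le _ (complex.Im (w - z))); rewrite -ReB.
by apply: (sq_le _ (complex.Re (w - z))); rewrite -ImB addrC.
Qed.

End ComplexPlane.

(** * The maximum principle *)

Section LogDerivative.
Variable R : realType.

(** [D] is the logarithmic derivative of [phi] and vanishes at the maximum. If its derivative there
    were positive, [D] and with it [phi'] would be positive just to the right of 0, and [phi] would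
    exceed its maximum. Working with [D] keeps logarithms out and asks for a second derivative at 0
    only. *)
Lemma log_derive_at_max (phi D : R -> R) :
  (\forall t \near (0 : R), is_derive (t : R^o) 1 phi (phi t * D t)) ->
  (\forall t \near (0 : R), 0 < phi t) ->
  (\forall t \near (0 : R), phi t <= phi 0) ->
  derivable D 0 1 -> derive1 D 0 <= 0.
Proof.
move=> phiD phi0 phimax dD; rewrite leNgt; apply/negP => D'0.
have : (fun h : R => h^-1 *: (D (h + 0) - D 0)) @ 0^' --> derive1 D 0.
  move: dD; rewrite /derivable /derive1 /=.
  under eq_fun do rewrite [_ *: 1]mulr1.
  by [].
move=> /cvgrPdist_lt/(_ _ D'0) Dq.
have [e e0 H] : exists2 e : R, 0 < e & forall t, `|t| < e ->
    [/\ is_derive (t : R^o) 1 phi (phi t * D t), 0 < phi t, phi t <= phi 0 &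
        t != 0 -> 0 < t^-1 * (D t - D 0)].
  have : \forall t \near (0 : R),
    [/\ is_derive (t : R^o) 1 phi (phi t * D t), 0 < phi t, phi t <= phi 0 &
        t != 0 -> 0 < t^-1 * (D t - D 0)].
    have {}Dq : \forall t \near (0 : R), t != 0 ->
      `|derive1 D 0 - t^-1 * (D (t + 0) - D 0)| < derive1 D 0 by exact: Dq.
    near=> t; split; try by near: t.
    move=> t0; have : `|derive1 D 0 - t^-1 * (D (t + 0) - D 0)| < derive1 D 0.
      by move: t0; near: t.
    rewrite addr0; move: (t^-1 * _) => x.
    by rewrite ltr_norml => /andP[_ ?]; lra.
  move=> /nbhs_ballP[e /= e0 He]; exists e => // t te; apply: He.
  by rewrite -ball_normE /= sub0r normrN.
have phider t : `|t| < e -> derivable phi t 1 /\ derive1 phi t = phi t * D t.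
  by move=> /H[ph _ _ _]; rewrite derive1E derive_val; split => //; exact: ex_derive.
(* The derivative [phi 0 * D 0] vanishes at an interior maximum, and [phi 0] is positive. *)
have D00 : D 0 = 0.
  have e2 : - (e / 2) <= e / 2 by lra.
  have lte t : t \in `]- (e / 2), e / 2[ -> `|t| < e.
    by rewrite in_itv /= => /andP[? ?]; rewrite ltr_norml; apply/andP; split; lra.
  have z0 : (0 : R) \in `](- (e / 2)), (e / 2)[ by rewrite in_itv /=; apply/andP; split; lra.
  have der0 : is_derive (0 : R^o) 1 phi 0.
    apply: (derive1_at_max e2 _ z0) => t /lte te; first exact: (phider t te).1.
    by have [] := H t te.
  have [_ +] := phider 0 (lte _ z0); rewrite derive1E.
  have -> : 'D_1 phi (0 : R^o) = 0 by case: der0.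
  move=> /esym/eqP.
  have [_ p0 _ _] := H 0 (lte _ z0).
  by rewrite mulf_eq0 gt_eqF //= => /eqP.
pose b := e / 2.
have b0 : 0 < b by rewrite /b; lra.
have incr : {in `[0, b] &, {homo phi : x y / x < y}}.
  have lte t : 0 <= t -> t <= b -> `|t| < e.
    by move=> t0 tb; rewrite ger0_norm//; move: tb; rewrite /b; lra.
  apply: gtr0_derive1_lt_cc => [t|t|].
  - rewrite in_itv /= => /andP[t0 tb].
    by have [] := phider t (lte t (ltW t0) (ltW tb)).
  - rewrite in_itv /= => /andP[t0 tb].
    have te := lte t (ltW t0) (ltW tb).
    have [_ ->] := phider t te.
    have [_ pt _] := H t te.
    rewrite gt_eqF// D00 subr0 => /(_ isT).
    by rewrite pmulr_rgt0 ?invr_gt0// => Dt; rewrite mulr_gt0.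
  - apply: derivable_within_continuous => t; rewrite in_itv /= => /andP[t0 tb].
    by have [] := phider t (lte t t0 tb).
have : phi 0 < phi b.
  by apply: incr => //; rewrite in_itv /= ?lexx ltW.
have be : `|b| < e by rewrite gtr0_norm// /b; lra.
have [_ _ pb _] := H b be.
by rewrite ltNge pb.
Unshelve. all: by end_near. Qed.

End LogDerivative.

(** * Second derivatives along horizontal and vertical lines *)

Section Slice.
(* [io] is either t |-> t or t |-> i t, and [L] accordingly Re or Im. *)
Variables (R : realType) (io : R -> R[i]) (L : R[i] -> R).
Hypothesis ioD : forall s t, io (s + t) = io s + io t.
Hypothesis io_cont : {for 0, continuous io}.
Hypothesis nsq_io : forall z t, nsq (z + io t) = nsq z + t * L z *+ 2 + t ^+ 2.

Lemma scaleRE (x y : R) : x *: (y : R^o) = x * y. Proof. by []. Qed.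

Definition slice (f : R[i] -> R) z t : R := f (z + io t).
Definition dslice (f : R[i] -> R) z : R := derive1 (slice f z) 0.

Lemma io0 : io 0 = 0.
Proof. by apply: (addrI (io 0)); rewrite -ioD !addr0. Qed.

Lemma slice0 f z : slice f z 0 = f z.
Proof. by rewrite /slice io0 addr0. Qed.

Lemma slice_near z (P : set R[i]) :
  (\forall w \near z, P w) -> \forall t \near (0 : R), P (z + io t).
Proof.
have : z + io t @[t --> (0 : R)] --> z.
  rewrite -[X in _ --> X]addr0 -io0.
  by apply: (@cvgD _ _ _ (nbhs (0 : R))); [exact: cvg_cst|exact: io_cont].
by apply.
Qed.

(** The slice through [z + io t] is the slice through [z] with its parameter translated by [t]. *)
Lemma is_derive_slice f z t : derivable (slice f (z + io t)) 0 1 ->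
  is_derive (t : R^o) 1 (slice f z) (dslice f (z + io t)).
Proof.
have shiftE : slice f (z + io t) = fun h => slice f z (h + t).
  by apply/funext => h; rewrite /slice -addrA -ioD (addrC t).
move=> df; have der : derivable (slice f z) (t : R^o) 1.
  apply/derivable1P; move: df; rewrite shiftE.
  suff -> : (fun h : R => slice f z (h + t)) =
            (fun h : R => slice f z (h *: (1 : R^o) + t)) by [].
  by apply/funext => h; rewrite [_ *: _]mulr1.
apply: DeriveDef => //; rewrite -derive1E /dslice /derive1 shiftE.
by under [in RHS]eq_fun do rewrite addr0 add0r.
Qed.

(* The inverse of the Poincare density of the disc of radius [rho] at [z0]. *)
Definition disc_weight z0 (rho : R) z : R := (rho ^+ 2 - nsq (z - z0)) / rho.

Lemma is_derive_weight z0 rho z t :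
  is_derive (t : R^o) 1 (slice (disc_weight z0 rho) z)
    ((- (L (z - z0) *+ 2) - t *+ 2) / rho).
Proof.
have -> : slice (disc_weight z0 rho) z =
  (cst (rho ^+ 2 - nsq (z - z0)) - (L (z - z0) *+ 2) *: id - id ^+ 2) * cst rho^-1.
  apply/funext => h; rewrite /slice /disc_weight.
  have -> : z + io h - z0 = z - z0 + io h by rewrite addrAC.
  rewrite nsq_io; set a := nsq _; set l := L _.
  rewrite !fctE [(l *+ 2) *: h]scaleRE.
  by congr (_ / _); ring.
apply: is_derive_eq; rewrite !fctE !scaleRE; ring.
Qed.

(** With [p] the weight along the line, [p' / p] has derivative [p'' / p - (p' / p)^2], where
    [p'' = -2 / rho] and, at time 0, [p' = -2 L (z - z0) / rho]. *)
Lemma derive_log_weight z0 rho z :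
  rho != 0 -> disc_weight z0 rho z != 0 ->
  is_derive (0 : R^o) 1
    (fun t : R => (- (L (z - z0) *+ 2) - t *+ 2) / rho / slice (disc_weight z0 rho) z t)
    (- 2 / (rho * disc_weight z0 rho z)
     - (2 * L (z - z0) / (rho * disc_weight z0 rho z)) ^+ 2).
Proof.
move=> rho0 w0; set l := L _; set p := slice _ _.
have p0 : p 0 = disc_weight z0 rho z by rewrite /p slice0.
have pn0 : p (0 : R) != 0 by rewrite p0.
have pd : is_derive (0 : R^o) 1 p ((- (l *+ 2) - 0 *+ 2) / rho).
  exact: is_derive_weight.
have -> : (fun t : R => (- (l *+ 2) - t *+ 2) / rho / p t) =
  (cst (- (l *+ 2) / rho) - (2 / rho) *: id) * (fun t => (p t)^-1).
  apply/funext => t; rewrite !fctE [(2 / rho) *: t]scaleRE.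
  by congr (_ / _); field.
have pV := is_deriveV pn0 pd.
apply: is_derive_eq; rewrite !fctE !scaleRE p0.
by field; rewrite w0 rho0.
Qed.

(** Along a line, [weight^(n+1) / g] has logarithmic derivative [(n+1) p' / p - g' / g], whose
    derivative at a maximum is at most 0. The horizontal and the vertical instance will be added to
    form the Laplacian. *)
Lemma slice_max_ineq n g z z0 rho :
  0 < rho -> 0 < disc_weight z0 rho z ->
  (\forall w \near z, 0 < g w /\ derivable (slice g w) 0 1) ->
  derivable (slice (dslice g) z) 0 1 ->
  (\forall w \near z,
     disc_weight z0 rho w ^+ n.+1 / g w <= disc_weight z0 rho z ^+ n.+1 / g z) ->
  n.+1%:R * (- 2 / (rho * disc_weight z0 rho z)
             - (2 * L (z - z0) / (rho * disc_weight z0 rho z)) ^+ 2)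
  <= dslice (fun w => dslice g w / g w) z.
Proof.
move=> rho0 w0 /slice_near gnear ddg /slice_near wmax.
set p := slice (disc_weight z0 rho) z.
pose p' (t : R) := (- (L (z - z0) *+ 2) - t *+ 2) / rho.
pose D (t : R) := n.+1%:R * (p' t / p t) - dslice g (z + io t) / g (z + io t).
pose q := n.+1%:R * (- 2 / (rho * disc_weight z0 rho z)
             - (2 * L (z - z0) / (rho * disc_weight z0 rho z)) ^+ 2).
have gz : 0 < g z by have [] := nbhs_singleton gnear; rewrite io0 addr0.
have dgz : derivable (slice g z) 0 1.
  by have [_] := nbhs_singleton gnear; rewrite io0 addr0.
have dlg : is_derive (0 : R^o) 1 (slice (fun w => dslice g w / g w) z)
  (dslice (fun w => dslice g w / g w) z).
  rewrite -{2}[z]addr0 -io0; apply: is_derive_slice; rewrite io0 addr0.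
  have -> : slice (fun w => dslice g w / g w) z =
    slice (dslice g) z * (fun t => (slice g z t)^-1) by [].
  apply: derivableM; first exact: ddg.
  by apply: derivableV; [rewrite slice0 gt_eqF|exact: dgz].
have dD : is_derive (0 : R^o) 1 D (q - dslice (fun w => dslice g w / g w) z).
  have dlp := @derive_log_weight z0 rho z (lt0r_neq0 rho0) (lt0r_neq0 w0).
  have -> : D = (n.+1%:R *: (fun t : R => p' t / p t)) -
     slice (fun w => dslice g w / g w) z.
    by apply/funext.
  by apply: is_derive_eq.
rewrite -subr_le0 -/q.
have -> : q - dslice (fun w => dslice g w / g w) z = derive1 D 0.
  by rewrite derive1E; case: dD.
have p0 : \forall t \near (0 : R), 0 < p t.
  have : {for (0 : R), continuous p}.
    apply: differentiable_continuous; apply/derivable1_diffP.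
    by case: (@is_derive_weight z0 rho z 0).
  by move=> pc; apply: (cvgr_gt _ pc); rewrite /p slice0.
apply: (@log_derive_at_max _ (fun t => p t ^+ n.+1 / g (z + io t))).
- near=> t.
  have [gt dgt] : 0 < g (z + io t) /\ derivable (slice g (z + io t)) 0 1 by near: t.
  have pt : 0 < p t by near: t.
  have dp : is_derive (t : R^o) 1 p (p' t) by exact: is_derive_weight.
  have dg := is_derive_slice dgt.
  have gtn0 : slice g z t != 0 by rewrite gt_eqF.
  have gV := is_deriveV gtn0 dg.
  have -> : (fun t => p t ^+ n.+1 / g (z + io t)) =
     (p ^+ n.+1) * (fun t => (slice g z t)^-1).
    by apply/funext => u; rewrite !fctE.
  apply: is_derive_eq; rewrite !fctE !scaleRE /D -/(slice g z t).
  move: (slice g z t) (p t) gtn0 pt => a b a0 /lt0r_neq0 b0.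
  rewrite exprS; field.
  by rewrite a0 b0.
- near=> t; rewrite divr_gt0 ?exprn_gt0//; first by near: t.
  by have [] : 0 < g (z + io t) /\ derivable (slice g (z + io t)) 0 1 by near: t.
- by move: wmax; apply: filterS => t; rewrite {2}/p slice0 io0 addr0.
- by case: dD.
Unshelve. all: by end_near. Qed.

End Slice.

(** * Comparison with the Poincare density *)

Section MaximumPrinciple.
Variable R : realType.
Implicit Types (z w : R[i]) (g : R[i] -> R).

(* Delta (ln g), in the form in which it occurs in the Chern curvature. *)
Definition log_laplacian g z : R :=
  dx (fun w => dx g w / g w) z + dy (fun w => dy g w / g w) z.

Lemma cvg_nsqB z0 z : nsq (w - z0) @[w --> z] --> nsq (z - z0).
Proof.
apply: (@cvg_comp _ _ _ (fun w => w - z0) (@nsq R)); last exact: continuous_nsq.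
by apply: (@cvgB _ _ _ (nbhs z)); [exact: cvg_id|exact: cvg_cst].
Qed.

Lemma cvg_weight z0 rho z :
  disc_weight z0 rho w @[w --> z] --> disc_weight z0 rho z.
Proof.
apply: (@cvgM _ _ (nbhs z)); last exact: cvg_cst.
by apply: (@cvgB _ _ _ (nbhs z)); [exact: cvg_cst|exact: cvg_nsqB].
Qed.

Lemma continuous_pureIm : {for 0, continuous (fun t : R => 0 +i* t)}.
Proof. by apply: cvg_Re_Im => /=; [exact: cvg_cst|exact: cvg_id]. Qed.

Lemma continuous_pureRe : {for 0, continuous (fun t : R => t%:C)}.
Proof. by apply: cvg_Re_Im => /=; [exact: cvg_id|exact: cvg_cst]. Qed.

(** The two directional inequalities sum to one with [(n+1) Delta ln p] on the left, and
    [Delta ln p = - 4 / p^2] is Liouville's equation for the Poincare density [1 / p]. *)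
Lemma log_laplacian_at_max n g (D : set R[i]) z z0 rho :
  open D -> class_C 2 D g -> (forall w, D w -> 0 < g w) ->
  D z -> 0 < rho -> 0 < disc_weight z0 rho z ->
  (\forall w \near z,
     disc_weight z0 rho w ^+ n.+1 / g w <= disc_weight z0 rho z ^+ n.+1 / g z) ->
  - (4 * n.+1%:R) / disc_weight z0 rho z ^+ 2 <= log_laplacian g z.
Proof.
move=> openD [_ [gx gy [_ [gxx _ _ _]] [_ [_ gyy _ _]]]] gpos Dz rho0 w0 wmax.
have Dnear : \forall w \near z, D w by apply: open_nbhs_nbhs.
have xnear : \forall w \near z,
    0 < g w /\ derivable (slice (real_complex R) g w) 0 1.
  by move: Dnear; apply: filterS => w Dw; split; [exact: gpos|exact: gx].
have ynear : \forall w \near z,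
    0 < g w /\ derivable (slice (fun t => 0 +i* t) g w) 0 1.
  by move: Dnear; apply: filterS => w Dw; split; [exact: gpos|exact: gy].
have ReD s t : (s + t)%:C = s%:C + t%:C :> R[i] by rewrite rmorphD.
have ImD (s t : R) : 0 +i* (s + t) = 0 +i* s + 0 +i* t by simpc.
have nsqRe w t : nsq (w + t%:C) = nsq w + t * complex.Re w *+ 2 + t ^+ 2.
  by case: w => a b; rewrite /nsq /=; ring.
have nsqIm w t : nsq (w + 0 +i* t) = nsq w + t * complex.Im w *+ 2 + t ^+ 2.
  by case: w => a b; rewrite /nsq /=; ring.
have hx := slice_max_ineq ReD continuous_pureRe nsqRe rho0 w0 xnear (gxx z Dz) wmax.
have hy := slice_max_ineq ImD continuous_pureIm nsqIm rho0 w0 ynear (gyy z Dz) wmax.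
apply: le_trans (lerD hx hy); rewrite -mulrDr.
set p := disc_weight z0 rho z in w0 *; set N : R := n.+1%:R.
have N0 : 0 <= N by rewrite ler0n.
have -> : - (4 * N) / p ^+ 2 = N * (- 4 / p ^+ 2).
  by field; rewrite lt0r_neq0.
apply: ler_wpM2l => //.
have rp : rho * p = rho ^+ 2 - nsq (z - z0).
  by rewrite /p /disc_weight; field; rewrite lt0r_neq0.
have -> : - 4 / p ^+ 2 = - 4 * rho ^+ 2 / (rho * p) ^+ 2.
  by field; rewrite !lt0r_neq0.
(* The first summand accounts for the two terms [-2 / (rho p)], the second for the two squares. *)
have -> : rho ^+ 2 = rho * p + nsq (z - z0) by rewrite rp; ring.
rewrite /nsq le_eqVlt; apply/orP; left; apply/eqP.
by field; rewrite !lt0r_neq0.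
Qed.

(** The weight is positive inside the disc and vanishes on its boundary circle, so a maximum over
    the compact closed disc lies in the open one. *)
Lemma exists_disc_max n g z0 rho : 0 < rho ->
  (forall z, nsq (z - z0) <= rho ^+ 2 -> 0 < g z /\ {for z, continuous g}) ->
  exists z, [/\ 0 < disc_weight z0 rho z,
    nsq (z - z0) < rho ^+ 2 &
    forall w, nsq (w - z0) <= rho ^+ 2 ->
     disc_weight z0 rho w ^+ n.+1 / g w <= disc_weight z0 rho z ^+ n.+1 / g z].
Proof.
move=> rho0 gP; pose A := [set w | nsq (w - z0) <= rho ^+ 2].
have Az0 : A z0 by rewrite /A /= subrr /nsq /= expr0n addr0 sqr_ge0.
have [||z /[!inE] Az zmax] := @compact_EVT_max _ _
    (fun w => disc_weight z0 rho w ^+ n.+1 / g w) A _ (@closed_disc_compact _ z0 rho).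
- by exists z0.
- apply: continuous_in_subspaceT => w /[!inE] Aw.
  have [gw gc] := gP w Aw.
  apply: (@cvgM _ _ (nbhs w)); last by apply: cvgV; rewrite ?gt_eqF.
  apply: (@cvg_comp _ _ _ (disc_weight z0 rho) (fun x => x ^+ n.+1)).
    exact: cvg_weight.
  exact: exprn_continuous.
have wz : 0 < disc_weight z0 rho z.
  have w0 : 0 <= disc_weight z0 rho z by rewrite divr_ge0 ?subr_ge0// ltW.
  rewrite lt_neqAle w0 andbT; apply/eqP => wE.
  have := zmax z0; rewrite inE => /(_ Az0).
  rewrite -wE expr0n /= mul0r leNgt divr_gt0 ?(proj1 (gP _ Az0))//.
  rewrite exprn_gt0// /disc_weight subrr /nsq /= expr0n /= addr0 subr0.
  by rewrite divr_gt0 ?exprn_gt0.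
exists z; split => //.
  by move: wz; rewrite /disc_weight pmulr_lgt0 ?invr_gt0// subr_gt0.
by move=> w Aw; apply: zmax; rewrite inE.
Qed.

Lemma disc_max_log_laplacian n g (D : set R[i]) z0 rho :
  open D -> class_C 2 D g -> (forall w, D w -> 0 < g w) -> 0 < rho ->
  (forall z, nsq (z - z0) <= rho ^+ 2 -> D z) ->
  exists z, [/\ 0 < disc_weight z0 rho z,
    nsq (z - z0) < rho ^+ 2,
    forall w, nsq (w - z0) <= rho ^+ 2 ->
     disc_weight z0 rho w ^+ n.+1 / g w <= disc_weight z0 rho z ^+ n.+1 / g z &
    - (4 * n.+1%:R) / disc_weight z0 rho z ^+ 2 <= log_laplacian g z].
Proof.
move=> openD gC gpos rho0 sD.
have [|z [wz zd zmax]] := @exists_disc_max n g z0 rho rho0.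
  by move=> z /sD Dz; split; [exact: gpos|exact: gC.1].
have Dz : D z by apply: sD; exact: ltW.
exists z; split => //; apply: (log_laplacian_at_max openD gC gpos Dz rho0 wz).
have zn : \forall w \near z, nsq (w - z0) < rho ^+ 2.
  exact: (@cvgr_lt _ _ (nbhs z) _ _ _ (@cvg_nsqB z0 z) _ zd).
by apply: filterS zn => w /ltW /zmax.
Qed.

End MaximumPrinciple.

(** * The estimate on a coordinate disc *)

Section DiscEstimate.
Variable R : realType.

(** The second inequality gives [b^3 <= a + b]. For [a < 1] this forces [b <= 2]. For [a >= 1] the
    first gives [a <= (3 + K) b], whence [b^2 <= 4 + K]; as [4 + K >= 1], both bounds follow. *)
Lemma cubic_bounds (a b K : R) : 0 < a -> 0 < b -> 0 <= K ->
  a / b <= 3 + K / a ^+ 2 -> b ^+ 2 <= a / b + 1 ->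
  a <= (4 + K) ^+ 2 /\ b <= 4 + K.
Proof.
move=> a0 b0 K0 hab hb.
have {}hb : b ^+ 3 <= a + b.
  have := ler_wpM2r (ltW b0) hb; rewrite mulrDl mul1r divfK ?lt0r_neq0//.
  by rewrite -exprSr.
have [a1|a1] := leP 1 a; last first.
  have b2 : b <= 2 by rewrite leNgt; apply/negP => b2; nra.
  by split; nra.
have {}hab : a <= b * (3 + K).
  have Ka : K / a ^+ 2 <= K.
    by rewrite ler_pdivrMr ?exprn_gt0// ler_peMr// exprn_ege1.
  by rewrite mulrC -ler_pdivrMr// (le_trans hab)// lerD2l.
have b2 : b ^+ 2 <= 4 + K.
  by rewrite -(ler_pM2l b0) -exprS; nra.
have bK : b <= 4 + K by nra.
by split => //; nra.
Qed.

(** Let [a] and [b] be the maxima of [weight^3 / g1] and [weight / g2]. The Laplacian inequality at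
    each maximum point, combined with the other maximum as a bound there, gives the hypotheses of
    [cubic_bounds]. On the disc of half the radius the weight is at least [3 rho / 4], so the bounds
    pass to [1 / g1] and [1 / g2]. *)
Lemma disc_estimate (g1 g2 N : R[i] -> R) (D : set R[i]) z0 rho K :
  open D -> class_C 2 D g1 -> class_C 2 D g2 ->
  (forall w, D w -> 0 < g1 w) -> (forall w, D w -> 0 < g2 w) ->
  (forall w, D w ->
     log_laplacian g1 w = 4 * (N w * g1 w ^+ 2 - g2 w / g1 w)) ->
  (forall w, D w -> log_laplacian g2 w = 4 * (g2 w / g1 w - g2 w ^- 2)) ->
  0 < rho -> 0 <= K ->
  (forall w, nsq (w - z0) <= rho ^+ 2 -> D w) ->
  (forall w, nsq (w - z0) <= rho ^+ 2 -> 0 <= N w /\ N w * rho ^+ 8 <= K) ->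
  forall w, nsq (w - z0) <= (rho / 2) ^+ 2 ->
    (g1 w)^-1 <= 3 * (4 + K) ^+ 2 / rho ^+ 3 /\
    (g2 w)^-1 <= 2 * (4 + K) / rho.
Proof.
move=> openD C1 C2 pos1 pos2 E1 E2 rho0 K0 sD NK.
have [x [wx xd xmax xlap]] := disc_max_log_laplacian 2 openD C1 pos1 rho0 sD.
have [y [wy yd ymax ylap]] := disc_max_log_laplacian 0 openD C2 pos2 rho0 sD.
have Dx := sD _ (ltW xd); have Dy := sD _ (ltW yd).
set a := disc_weight z0 rho x ^+ 3 / g1 x in xmax.
set b := disc_weight z0 rho y ^+ 1 / g2 y in ymax.
have a0 : 0 < a by rewrite divr_gt0 ?exprn_gt0 ?pos1.
have b0 : 0 < b by rewrite divr_gt0 ?exprn_gt0 ?pos2.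
have [aK bK] : a <= (4 + K) ^+ 2 /\ b <= 4 + K.
  apply: cubic_bounds => //.
  - move: xlap; rewrite E1// => xlap.
    have := ymax x (ltW xd); rewrite expr1.
    have [N0 NxK] := NK x (ltW xd).
    have g1x := pos1 x Dx; have g2x := pos2 x Dx.
    move: xlap; rewrite /a.
    have pr : disc_weight z0 rho x <= rho.
      by rewrite /disc_weight ler_pdivrMr// -expr2 lerBlDr lerDl nsq_ge0.
    set p := disc_weight z0 rho x in wx pr *.
    have {NxK}Np : N x * p ^+ 8 <= K.
      apply: le_trans NxK; rewrite ler_wpM2l//.
      by rewrite lerXn2r ?nnegrE// ltW.
    move: (N x) (g1 x) (g2 x) N0 g1x g2x Np => n u v n0 u0 v0 np.
    move=> lap pvb.
    have p2 : 0 < p ^+ 2 by rewrite exprn_gt0.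
    (* The inequality of Laplacians at [x], multiplied by [p^2 / 4]. *)
    have h1 : p ^+ 2 * (v / u) <= 3 + p ^+ 2 * (n * u ^+ 2).
      have := ler_wpM2l (ltW p2) lap.
      have -> : p ^+ 2 * (- (4 * 3%:R) / p ^+ 2) = - (4 * 3%:R).
        by field; rewrite lt0r_neq0.
      by rewrite mulrCA mulrBr; set A := p ^+ 2 * (v / u); lra.
    (* [b] bounds [p / v] at [x] too, so [a / b <= a v / p = p^2 v / u]. *)
    apply: (@le_trans _ _ (p ^+ 2 * (v / u))).
      rewrite ler_pdivrMr//.
      have -> : p ^+ 3 / u = p ^+ 2 * (v / u) * (p / v).
        by field; rewrite !lt0r_neq0.
      by rewrite ler_wpM2l// mulr_ge0 ?ltW ?divr_gt0.
    apply: (le_trans h1); rewrite lerD2l.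
    (* The exponent 8 arises here: [a = p^3 / u], so [p^2 u^2 = p^8 / a^2]. *)
    have -> : p ^+ 2 * (n * u ^+ 2) = n * p ^+ 8 / (p ^+ 3 / u) ^+ 2.
      by field; rewrite !lt0r_neq0.
    by rewrite ler_wpM2r// invr_ge0 exprn_ge0// divr_ge0 ?exprn_ge0 ?ltW.
  - move: ylap; rewrite E2// => ylap.
    have := xmax y (ltW yd).
    have g1y := pos1 y Dy; have g2y := pos2 y Dy.
    move: ylap b0; rewrite /b expr1.
    set p := disc_weight z0 rho y in wy *.
    move: (g1 y) (g2 y) g1y g2y => u v u0 v0 lap b0 pua.
    have p2 : 0 < p ^+ 2 by rewrite exprn_gt0.
    have h1 : (p / v) ^+ 2 <= p ^+ 2 * (v / u) + 1.
      have := ler_wpM2l (ltW p2) lap.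
      have -> : p ^+ 2 * (- (4 * 1%:R) / p ^+ 2) = - 4.
        by field; rewrite lt0r_neq0.
      have -> : p ^+ 2 * (4 * (v / u - v ^- 2)) =
                4 * (p ^+ 2 * (v / u)) - 4 * (p / v) ^+ 2.
        by field; rewrite !lt0r_neq0.
      by move: (p ^+ 2 * (v / u)) ((p / v) ^+ 2) => A B; lra.
    apply: (le_trans h1); rewrite lerD2r.
    (* At [y] the roles are exchanged: [p / v = b] and [p^3 / u <= a]. *)
    have -> : p ^+ 2 * (v / u) = (p ^+ 3 / u) / (p / v).
      by field; rewrite !lt0r_neq0.
    by rewrite ler_wpM2r// invr_ge0 ltW.
move=> w wd.
have wd1 : nsq (w - z0) <= rho ^+ 2.
  by apply: (le_trans wd); rewrite expr_div_n ler_piMr ?sqr_ge0// invf_le1; lra.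
have Dw := sD w wd1.
have := xmax w wd1; have := ymax w wd1; rewrite expr1.
have g1w := pos1 w Dw; have g2w := pos2 w Dw.
have pw : 3 / 4 * rho <= disc_weight z0 rho w.
  rewrite /disc_weight ler_pdivlMr//.
  by move: wd; set m := nsq _; nra.
move: (disc_weight z0 rho w) pw => p pw hy hx.
have p0 : 0 < p by nra.
have hy' : p / g2 w <= 4 + K by exact: le_trans bK.
have hx' : p ^+ 3 / g1 w <= (4 + K) ^+ 2 by exact: le_trans aK.
(* [(3/4)^3 = 27/64] is at least [1/3]. *)
have pw3 : rho ^+ 3 <= 3 * p ^+ 3.
  have : (3 / 4 * rho) ^+ 3 <= p ^+ 3.
    by rewrite lerXn2r ?nnegrE//; nra.
  have : 0 < rho ^+ 3 by rewrite exprn_gt0.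
  rewrite exprMn; set r3 := rho ^+ 3; set p3 := p ^+ 3; lra.
have i1 : 0 <= (g1 w)^-1 by rewrite invr_ge0 ltW.
have i2 : 0 <= (g2 w)^-1 by rewrite invr_ge0 ltW.
split.
  rewrite ler_pdivlMr ?exprn_gt0//.
  have := ler_wpM2l i1 pw3; move: hx'; rewrite [_ / g1 w]mulrC.
  by rewrite mulrCA; lra.
rewrite ler_pdivlMr//.
have : (g2 w)^-1 * rho <= (g2 w)^-1 * (2 * p) by rewrite ler_wpM2l//; nra.
move: hy'; rewrite [_ / g2 w]mulrC.
by rewrite mulrCA; lra.
Qed.

End DiscEstimate.

(** * The self-duality equation for a diagonal metric *)

Section HitchinDiagonal.
Variable R : realType.

Lemma near_dx (f g : R[i] -> R) z : (\forall w \near z, f w = g w) -> dx f z = dx g z.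
Proof.
move=> fg; rewrite /dx !derive1E; apply: near_eq_derive.
have := @slice_near R (real_complex R) _ (@continuous_pureRe R) z _ fg.
by apply => s t; rewrite rmorphD.
Qed.

Lemma near_dy (f g : R[i] -> R) z : (\forall w \near z, f w = g w) -> dy f z = dy g z.
Proof.
move=> fg; rewrite /dy !derive1E; apply: near_eq_derive.
have := @slice_near R (fun t => 0 +i* t) _ (@continuous_pureIm R) z _ fg.
by apply => s t; simpc.
Qed.

Lemma d_z_real (f : R[i] -> R) z :
  d_z (fun w => (f w)%:C) z = (dx f z / 2) +i* (- (dy f z / 2)).
Proof.
have dx0 : dx (fun _ : R[i] => 0 : R) z = 0 by rewrite /dx derive1_cst.
have dy0 : dy (fun _ : R[i] => 0 : R) z = 0 by rewrite /dy derive1_cst.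
rewrite /d_z /cdx /cdy.
rewrite [dx (@complex.Im R \o _) z]dx0 [dy (@complex.Im R \o _) z]dy0.
rewrite [dx (@complex.Re R \o _) z](_ : _ = dx f z)//.
rewrite [dy (@complex.Re R \o _) z](_ : _ = dy f z)//.
have -> : (2 : R[i]) = 2%:C by rewrite rmorph_nat.
rewrite -[2%:C^-1]fmorphV.
by apply/eqP; rewrite eq_complex /=; apply/andP; split; apply/eqP; ring.
Qed.

Lemma Re_d_zbar (f : R[i] -> R[i]) z :
  complex.Re (d_zbar f z) =
  (dx (@complex.Re R \o f) z - dy (@complex.Im R \o f) z) / 2.
Proof.
rewrite /d_zbar /cdx /cdy.
have -> : (2 : R[i]) = 2%:C by rewrite rmorph_nat.
rewrite -[2%:C^-1]fmorphV /=; ring.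
Qed.

Lemma dx_half (f : R[i] -> R) z : derivable (slice_x f z) 0 1 ->
  dx (fun w => f w / 2) z = dx f z / 2.
Proof.
move=> df; rewrite /dx; transitivity (derive1 (fun t => slice_x f z t * 2^-1) 0) => //.
by rewrite derive1Mr.
Qed.

Lemma dy_half (f : R[i] -> R) z : derivable (slice_y f z) 0 1 ->
  dy (fun w => f w / 2) z = dy f z / 2.
Proof.
move=> df; rewrite /dy; transitivity (derive1 (fun t => slice_y f z t * 2^-1) 0) => //.
by rewrite derive1Mr.
Qed.

Lemma dyN (f : R[i] -> R) z : derivable (slice_y f z) 0 1 ->
  dy (fun w => - f w) z = - dy f z.
Proof.
move=> df; rewrite /dy; transitivity (derive1 (- slice_y f z) 0) => //.
by rewrite !derive1E deriveN.
Qed.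

(** For real [g], [d_z g = (g_x - i g_y) / 2]; the real part of [d_zbar (d_z g / g)] then involves
    unmixed second derivatives only, and these form a quarter of the Laplacian of [ln g]. *)
Lemma Re_curvature (g : R[i] -> R) (D : set R[i]) z :
  class_C 2 D g -> (forall w, D w -> 0 < g w) -> D z ->
  complex.Re (d_zbar (fun w => ((g w)^-1)%:C * d_z (fun w => (g w)%:C) w) z) =
  log_laplacian g z / 4.
Proof.
move=> [_ [gx gy [_ [gxx _ _ _]] [_ [_ gyy _ _]]]] gpos Dz; rewrite Re_d_zbar.
have gz0 : g z != 0 by rewrite gt_eqF ?gpos.
have x0 : z + (0 : R)%:C = z by rewrite addr0.
have y0 : z + 0 +i* 0 = z by rewrite addr0.
have dxg : derivable (slice_x (fun w => dx g w / g w) z) 0 1.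
  have -> : slice_x (fun w => dx g w / g w) z =
    slice_x (dx g) z * (fun t => (slice_x g z t)^-1) by [].
  apply: derivableM; first exact: gxx.
  by apply: derivableV; [rewrite /slice_x x0|exact: gx].
have dyg : derivable (slice_y (fun w => dy g w / g w) z) 0 1.
  have -> : slice_y (fun w => dy g w / g w) z =
    slice_y (dy g) z * (fun t => (slice_y g z t)^-1) by [].
  apply: derivableM; first exact: gyy.
  by apply: derivableV; [rewrite /slice_y y0|exact: gy].
have -> : @complex.Re R \o (fun w => ((g w)^-1)%:C * d_z (fun w => (g w)%:C) w) =
    (fun w => dx g w / g w / 2).
  by apply/funext => w; rewrite /comp d_z_real /=; ring.
have -> : @complex.Im R \o (fun w => ((g w)^-1)%:C * d_z (fun w => (g w)%:C) w) =
    (fun w => - (dy g w / g w / 2)).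
  by apply/funext => w; rewrite /comp d_z_real /=; ring.
rewrite dyN; last first.
  have -> : slice_y (fun w => dy g w / g w / 2) z =
    slice_y (fun w => dy g w / g w) z * cst 2^-1 by [].
  by apply: derivableM; [exact: dyg|exact: derivable_cst].
by rewrite dx_half// dy_half// /log_laplacian; field.
Qed.

Lemma invmx_diag (F : fieldType) n (d : 'rV[F]_n) : (forall i, d 0 i != 0) ->
  invmx (diag_mx d) = diag_mx (\row_i (d 0 i)^-1).
Proof.
move=> d0; have e : diag_mx d *m diag_mx (\row_i (d 0 i)^-1) = 1%:M.
  apply/matrixP => i j; rewrite mul_diag_mx !mxE.
  by have [->|_] := eqVneq i j; rewrite ?mulr1n ?divff// !mulr0n mulr0.
have [u _] := mulmx1_unit e.
by rewrite -[RHS]mul1mx -(mulVmx u) -mulmxA e mulmx1.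
Qed.

(** The entry [(j, i)] of the adjoint is the conjugate of [Phi i j] times [d i / d j], so each
    product contributes a squared modulus. *)
Lemma Re_commutator_adjoint_diag (d : 'I_4 -> R) (Phi : 'M[R[i]]_4) i :
  (forall j, d j != 0) ->
  complex.Re
    (mx_commutator Phi (mx_adjoint (diag_mx (\row_j (d j)%:C)) Phi) i i) =
  \sum_j nsq (Phi i j) * (d i / d j) - \sum_j nsq (Phi j i) * (d j / d i).
Proof.
move=> d0; have dC0 j : (\row_j (d j)%:C) 0 j != 0.
  by rewrite mxE fmorph_eq0.
rewrite -[RHS]/(complex.Re (_%:C)); congr (complex.Re _).
rewrite rmorphB !rmorph_sum /mx_commutator /mx_adjoint invmx_diag//.
rewrite [LHS]mxE [X in X + _]mxE [X in _ + X]mxE [X in _ - X]mxE.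
congr (_ - _); apply: eq_bigr => j _.
  rewrite mul_mx_diag mul_diag_mx !mxE !rmorphM /= nsq_norm normCK fmorphV.
  by ring.
rewrite mul_mx_diag mul_diag_mx !mxE !rmorphM /= nsq_norm normCK fmorphV.
by ring.
Qed.

End HitchinDiagonal.

(** * The scalar equations for [g1] and [g2] *)

Section HitchinScalar.
Variables (R : realType) (X : riemann_surface R).

Definition diag_weights (x y : R) (j : 'I_4) : R :=
  nth 0 [:: x; y^-1; x^-1; y] j.

Lemma diag_weights_neq0 x y j : 0 < x -> 0 < y -> diag_weights x y j != 0.
Proof.
move=> x0 y0.
rewrite /diag_weights.
by case: j => [[|[|[|[|j]]]] jlt] //=; rewrite ?invr_eq0 gt_eqF.
Qed.

Lemma diag_metricE (g1 g2 : local_fun X R) a z :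
  diag_metric g1 g2 a z =
  diag_mx (\row_j (diag_weights (g1 a z) (g2 a z) j)%:C).
Proof.
rewrite /diag_metric; congr diag_mx; apply/rowP => j; rewrite !mxE.
by case: j => [[|[|[|[|j]]]] jlt].
Qed.

(** Since [H] is diagonal, the [i]-th diagonal entry of [H^-1 dH] is [d_z g / g]. The inverse is
    computed where the weights are known to be positive, on the unit disc, so the two sides are
    compared as germs at [z]. *)
Lemma curvature_diag (g1 g2 : local_fun X R) a z i (g : R[i] -> R) :
  (forall w, unit_disc w -> 0 < g1 a w /\ 0 < g2 a w) ->
  (forall w, diag_weights (g1 a w) (g2 a w) i = g w) ->
  class_C 2 (@unit_disc R) g -> (forall w, unit_disc w -> 0 < g w) ->
  unit_disc z ->
  complex.Re (chern_curvature (diag_metric g1 g2) a z i i) = - (log_laplacian g z / 4).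
Proof.
move=> gpos gE gC g0 Dz; rewrite /chern_curvature !mxE.
rewrite -(Re_curvature gC g0 Dz).
set f := fun w => (invmx _ *m _) i i; set h := fun w => _ * _.
have fh : \forall w \near z, f w = h w.
  have := unit_disc_nbhs Dz; apply: filterS => w Dw.
  have [g1w g2w] := gpos w Dw.
  rewrite /f /h diag_metricE invmx_diag; last first.
    by move=> j; rewrite mxE fmorph_eq0 diag_weights_neq0.
  rewrite mul_diag_mx [LHS]mxE [X in X * _]mxE [X in X^-1]mxE [X in _ * X]mxE gE.
  rewrite -fmorphV; congr (_ * _).
  apply: (congr1 (fun u => d_z u w)); apply/funext => v.
  by rewrite diag_metricE mxE eqxx mulr1n mxE gE.
have fR : \forall w \near z, (@complex.Re R \o f) w = (@complex.Re R \o h) w.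
  by apply: filterS fh => w /= ->.
have fI : \forall w \near z, (@complex.Im R \o f) w = (@complex.Im R \o h) w.
  by apply: filterS fh => w /= ->.
have ReN (w : R[i]) : complex.Re (- w) = - complex.Re w by case: w.
by rewrite ReN !Re_d_zbar (near_dx fR) (near_dy fI).
Qed.

#[local] Arguments nsq : simpl never.

(** These are the diagonal entries 0 and 3 of the matrix equation. Row 0 of the Higgs field contains
    [q] and column 0 contains 1; row 3 and column 3 contain 1 each. *)
Lemma hitchin_scalar (q : local_fun X R[i]) (g1 g2 : local_fun X R) a z :
  class_C 2 (@unit_disc R) (g1 a) -> class_C 2 (@unit_disc R) (g2 a) ->
  (forall w, unit_disc w -> 0 < g1 a w) -> (forall w, unit_disc w -> 0 < g2 a w) ->
  hitchin_equation q (diag_metric g1 g2) -> unit_disc z ->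
  log_laplacian (g1 a) z = 4 * (nsq (q a z) * g1 a z ^+ 2 - g2 a z / g1 a z) /\
  log_laplacian (g2 a) z = 4 * (g2 a z / g1 a z - g2 a z ^- 2).
Proof.
move=> C1 C2 p1 p2 hit Dz.
have gpos w : unit_disc w -> 0 < g1 a w /\ 0 < g2 a w.
  by move=> Dw; split; [exact: p1|exact: p2].
have ReD (v w : R[i]) : complex.Re (v + w) = complex.Re v + complex.Re w.
  by case: v w => ? ? [].
have g1z := p1 z Dz; have g2z := p2 z Dz.
have d0 j := diag_weights_neq0 j g1z g2z.
have n0 : nsq (0 : R[i]) = 0 by rewrite /nsq /= expr0n addr0.
have n1 : nsq (1 : R[i]) = 1 by rewrite /nsq /= expr0n expr1n addr0.
have diagE i (g : R[i] -> R) : (forall w, diag_weights (g1 a w) (g2 a w) i = g w) ->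
    class_C 2 (@unit_disc R) g -> (forall w, unit_disc w -> 0 < g w) ->
    log_laplacian g z = 4 * (
     \sum_j nsq (higgs_mx (q a z) i j) *
        (diag_weights (g1 a z) (g2 a z) i / diag_weights (g1 a z) (g2 a z) j) -
     \sum_j nsq (higgs_mx (q a z) j i) *
        (diag_weights (g1 a z) (g2 a z) j / diag_weights (g1 a z) (g2 a z) i)).
  move=> gE Cg g0; have := hit a z Dz => /matrixP/(_ i i).
  rewrite [LHS]mxE [RHS]mxE => /(congr1 (@complex.Re R)).
  rewrite ReD (curvature_diag gpos gE Cg g0 Dz) diag_metricE.
  rewrite Re_commutator_adjoint_diag//=.
  by move: (_ - _) => S; lra.
have i0 : (0 < 4)%N by [].
have i3 : (3 < 4)%N by [].
split.
  rewrite (diagE (Ordinal i0))// !big_ord_recl !big_ord0 !mxE /diag_weights /=.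
  by rewrite !n0 n1; field; rewrite !gt_eqF.
rewrite (diagE (Ordinal i3))// !big_ord_recl !big_ord0 !mxE /diag_weights /=.
by rewrite !n0 n1; field; rewrite !gt_eqF.
Qed.

End HitchinScalar.

(** * Metric balls inside a coordinate disc *)

Section CurveDerivative.
Variable R : realType.

Lemma derivable_cvg (f : R -> R) (t : R) : derivable f t 1 ->
  h^-1 * (f (h + t) - f t) @[h --> 0^'] --> derive1 f t.
Proof.
rewrite /derivable /derive1 /=.
by under eq_fun do rewrite [_ *: 1]mulr1.
Qed.

Lemma cvg_derivable (f : R -> R) (t l : R) :
  h^-1 * (f (h + t) - f t) @[h --> 0^'] --> l -> is_derive (t : R^o) 1 f l.
Proof.
move=> fl; apply: DeriveDef.
  rewrite /derivable; apply/cvg_ex; exists l => /=.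
  by under eq_fun do rewrite [_ *: 1]mulr1.
by rewrite -derive1E; apply/cvg_lim.
Qed.

Lemma is_derive_posq (x : R) :
  is_derive (x : R^o) 1 (fun y => Num.max 0 y ^+ 2) (2 * Num.max 0 x).
Proof.
have [x0|x0|<-] := ltgtP 0 x.
- apply: (@near_eq_is_derive _ _ _ (fun y : R^o => y ^+ 2)).
    near=> y; rewrite max_r// ltW//; near: y.
    exact: lt_nbhsr.
  by apply: is_derive_eq; rewrite [_ *: 1]mulr1 mulr_natl mulr2n.
- rewrite mulr0; apply: (@near_eq_is_derive _ _ _ (cst 0)).
  near=> y; rewrite max_l ?expr0n// ltW//; near: y.
  exact: lt_nbhsl.
(* At 0 the slope function is [max(0, y)] itself, since [max(0, y)^2 = max(0, y) y]. *)
- rewrite mulr0; apply/is_derive1_caratheodory.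
  exists (fun y => Num.max 0 y); split.
  + move=> z; rewrite maxxx expr0n subr0 subr0.
    by have [z0|z0] := leP 0 z; rewrite expr2// !mul0r.
  + apply: (@continuous_max _ _ (cst 0) id); [exact: cvg_cst|exact: cvg_id].
  + by rewrite maxxx.
Unshelve. all: by end_near. Qed.

Lemma cvg_difference_quotient (T : R[i] -> R[i]) w0 : derivable T w0 1 ->
  (if w == w0 then derive1 T w0 else (T w - T w0) / (w - w0)) @[w --> w0]
    --> derive1 T w0.
Proof.
move=> dT.
have : h^-1 * (T (h + w0) - T w0) @[h --> 0^'] --> derive1 T w0.
  move: dT; rewrite /derivable /derive1 /=.
  by under eq_fun do rewrite [_ *: 1]mulr1.
move=> /cvgrPdist_lt dT'.
apply/(@cvgrPdist_lt _ _ _ (nbhs w0)) => e e0.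
have {dT'} : \forall h \near (0 : R[i]), h != 0 ->
    `|derive1 T w0 - h^-1 * (T (h + w0) - T w0)| < e := dT' e e0.
move=> /nbhs_ballP[d d0 dP].
have := nbhsx_ballx w0 _ d0; apply: filterS => w.
rewrite -ball_normE /= distrC => ww0.
case: eqVneq => [_|wn]; first by rewrite subrr normr0.
have := dP (w - w0); rewrite -ball_normE /= sub0r normrN => /(_ ww0).
by rewrite subr_eq0 subrK mulrC => /(_ wn).
Qed.

(** This form serves the chain rule for a complex function along a real curve: it avoids division by
    the increments of the curve, which may vanish. *)
Lemma caratheodory_factor (T : R[i] -> R[i]) w0 : derivable T w0 1 ->
  exists S : R[i] -> R[i], [/\ forall w, T w - T w0 = S w * (w - w0),
    S w0 = derive1 T w0 & {for w0, continuous S}].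
Proof.
move=> dT.
exists (fun w => if w == w0 then derive1 T w0 else (T w - T w0) / (w - w0)).
split; last 1 first.
- suff : (if w == w0 then derive1 T w0 else (T w - T w0) / (w - w0)) @[w --> w0]
      --> derive1 T w0.
    by move=> h; rewrite /prop_for /continuous_at eqxx.
  exact: cvg_difference_quotient.
- move=> w; case: eqVneq => [->|ww0]; first by rewrite !subrr mulr0.
  by rewrite divfK// subr_eq0.
- by rewrite eqxx.
Qed.

(** The curve [T o c] has velocity [D = T'(c t) c'(t)], and the squared distance to [z0] changes at
    twice the scalar product of [T (c t) - z0] with [D]. The bound is Cauchy-Schwarz. *)
Lemma is_derive_nsq_curve (T : R[i] -> R[i]) (c : R -> R[i]) (t : R) z0 :
  derivable T (c t) 1 ->
  derivable (@complex.Re R \o c) t 1 -> derivable (@complex.Im R \o c) t 1 ->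
  exists2 d, is_derive (t : R^o) 1 (fun s => nsq (T (c s) - z0)) d &
   d ^+ 2 <= 4 * nsq (T (c t) - z0) * (nsq (derive1 T (c t)) *
    (derive1 (@complex.Re R \o c) t ^+ 2 + derive1 (@complex.Im R \o c) t ^+ 2)).
Proof.
move=> dT du dv; have [S [TS S0 Sc]] := caratheodory_factor dT.
set u' := derive1 (@complex.Re R \o c) t; set v' := derive1 (@complex.Im R \o c) t.
set D := derive1 T (c t) * (u' +i* v').
have cc : c (h + t) @[h --> 0^'] --> c t.
  have cR : {for t, continuous (@complex.Re R \o c)}.
    by apply/differentiable_continuous/derivable1_diffP.
  have cI : {for t, continuous (@complex.Im R \o c)}.
    by apply/differentiable_continuous/derivable1_diffP.
  have sh : h + t @[h --> (0 : R)^'] --> t.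
    rewrite -[X in _ --> X]add0r; apply: cvgD; last exact: cvg_cst.
    exact: cvg_within.
  apply: cvg_Re_Im.
    exact: (@cvg_comp _ _ _ (fun h => h + t) (@complex.Re R \o c) _ _ _ sh cR).
  exact: (@cvg_comp _ _ _ (fun h => h + t) (@complex.Im R \o c) _ _ _ sh cI).
have cd : (h^-1)%:C * (c (h + t) - c t) @[h --> 0^'] --> u' +i* v'.
  apply: cvg_Re_Im.
    apply: cvg_trans (derivable_cvg du); apply: near_eq_cvg; apply: nearW => h.
    by rewrite Re_realM ReB.
  apply: cvg_trans (derivable_cvg dv); apply: near_eq_cvg; apply: nearW => h.
  by rewrite Im_realM ImB.
have Tc : (h^-1)%:C * (T (c (h + t)) - T (c t)) @[h --> 0^'] --> D.
  have -> : (fun h => (h^-1)%:C * (T (c (h + t)) - T (c t))) =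
     (fun h => S (c (h + t)) * ((h^-1)%:C * (c (h + t) - c t))).
    by apply/funext => h; rewrite TS; ring.
  have Sc' : S (c (h + t)) @[h --> 0^'] --> derive1 T (c t).
    by rewrite -S0; exact: (@cvg_comp _ _ _ (fun h => c (h + t)) S _ _ _ cc Sc).
  exact: (cvgM Sc' cd).
have dRe : is_derive (t : R^o) 1 (fun s => complex.Re (T (c s))) (complex.Re D).
  apply: cvg_derivable.
  have cv := @cvg_comp _ _ _ (fun h => (h^-1)%:C * (T (c (h + t)) - T (c t)))
    (@complex.Re R) _ _ _ Tc (@continuous_Re R D).
  apply: cvg_trans cv; apply: near_eq_cvg; apply: nearW => h.
  by rewrite /= Re_realM ReB.
have dIm : is_derive (t : R^o) 1 (fun s => complex.Im (T (c s))) (complex.Im D).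
  apply: cvg_derivable.
  have cv := @cvg_comp _ _ _ (fun h => (h^-1)%:C * (T (c (h + t)) - T (c t)))
    (@complex.Im R) _ _ _ Tc (@continuous_Im R D).
  apply: cvg_trans cv; apply: near_eq_cvg; apply: nearW => h.
  by rewrite /= Im_realM ImB.
set z := T (c t) - z0.
exists (2 * (complex.Re z * complex.Re D + complex.Im z * complex.Im D)).
  have -> : (fun s => nsq (T (c s) - z0)) =
     ((fun s => complex.Re (T (c s))) - cst (complex.Re z0)) ^+ 2 +
     ((fun s => complex.Im (T (c s))) - cst (complex.Im z0)) ^+ 2.
    by apply/funext => s; rewrite /nsq ReB ImB.
  apply: is_derive_eq; rewrite !fctE /z ReB ImB /GRing.scale /=; ring.
have -> : nsq (derive1 T (c t)) * (u' ^+ 2 + v' ^+ 2) = nsq D.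
  by rewrite /D nsqM.
rewrite /nsq; move: (complex.Re z) (complex.Im z) (complex.Re D) (complex.Im D) => a b x y.
(* By Lagrange's identity this square is the defect in Cauchy-Schwarz. *)
have := sqr_ge0 (a * y - b * x); nra.
Qed.

End CurveDerivative.

(** * A function that drops slowly along paths *)

Section MetricBall.
Variables (R : realType) (X : riemann_surface R).
Variables (sigma : local_fun X R) (sigma_conf : conformal_metric sigma).
Hypothesis X_hausdorff : hausdorff_space X.
Variables (a0 : chart X) (p : X) (delta m : R).
Hypotheses (pa0 : dom a0 p) (delta0 : 0 < delta) (m0 : 0 < m).
Let z0 := crd a0 p.
Hypothesis disc_sub : forall z, nsq (z - z0) <= delta ^+ 2 ->
  unit_disc z /\ m <= sigma a0 z.

(* The square makes the extension by 0 differentiable across the circle of radius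
   [delta]; the drop of [bump] along a path is bounded by its length. *)
Definition bump (x : X) : R :=
  if `[< dom a0 x >]
  then Num.max 0 (delta ^+ 2 - nsq (crd a0 x - z0)) ^+ 2 else 0.

Lemma bump_gt0 x : 0 < bump x -> dom a0 x /\ nsq (crd a0 x - z0) < delta ^+ 2.
Proof.
rewrite /bump; case: asboolP => [dx|_]; last by rewrite ltxx.
have [h|h] := leP 0 (delta ^+ 2 - nsq (crd a0 x - z0)).
  rewrite exprn_even_gt0//= => h0; split => //.
  by rewrite -subr_gt0 lt_neqAle h andbT eq_sym.
by rewrite expr0n /= ltxx.
Qed.

Lemma bump_center : bump p = delta ^+ 4.
Proof.
rewrite /bump; case: asboolP => // _.
rewrite -/z0 subrr; have -> : nsq (0 : R[i]) = 0 by rewrite /nsq /= expr0n addr0.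
by rewrite subr0 max_r ?sqr_ge0// -exprM.
Qed.

Lemma near_par (b : chart X) (c : R -> R[i]) (t : R) (U : set X) :
  {for t, continuous c} -> unit_disc (c t) -> open U -> U (par b (c t)) ->
  \forall s \near t, U (par b (c s)) /\ unit_disc (c s).
Proof.
move=> cc Dt oU Ut.
have Dn : \forall s \near t, unit_disc (c s) by apply: cc; exact: unit_disc_nbhs.
have Un : \forall s \near t, U (par b (c s)).
  apply: (@cvg_comp _ _ _ c (par b) _ _ _ cc).
    have := @par_continuous _ X b.
    rewrite continuous_open_subspace; last exact: unit_disc_open.
    by move=> /(_ (c t)); rewrite inE; apply.
  exact: open_nbhs_nbhs.
by near=> s; split; near: s.
Unshelve. all: by end_near. Qed.

(** The image of the compact disc is closed because [X] is Hausdorff. A curve that is outside the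
    chart domain at some time therefore avoids the disc at nearby times, and [bump] is 0 there. *)
Lemma outside_open :
  open (~` (par a0 @` [set z | nsq (z - z0) <= delta ^+ 2]) : set X).
Proof.
apply: closed_openC; apply: compact_closed => //.
apply: continuous_compact; last exact: closed_disc_compact.
apply: (@continuous_subspaceW _ _ _ (@unit_disc R)); last exact: par_continuous.
by move=> z /disc_sub[].
Qed.

Lemma conformal_nsq a b z : overlap a b z ->
  sigma a z = sigma b (trans a b z) * nsq (jac a b z).
Proof.
move=> ov; have [_ _ /(_ _ _ _ ov)] := sigma_conf.
by rewrite -nsq_norm -rmorphM => /complexI.
Qed.

(** Let [N] be the squared distance to [z0] in the chart [a0]. Inside the disc the derivative is
    [-2 (delta^2 - N) N'], with [delta^2 - N <= delta^2] and [N'] at most [2 delta] times the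
    Euclidean speed. As [sigma >= m] there, that speed is at most the [sigma]-speed divided by
    [sqrt m]; conformality allows the [sigma]-speed to be read in the chart [b]. *)
Lemma bump_derivable (b : chart X) (c : R -> R[i]) (t : R) :
  derivable (@complex.Re R \o c) t 1 -> derivable (@complex.Im R \o c) t 1 ->
  unit_disc (c t) ->
  exists2 d, is_derive (t : R^o) 1 (fun s => bump (par b (c s))) d &
    `|d| <= 4 * delta ^+ 3 / Num.sqrt m *
      (Num.sqrt (sigma b (c t)) *
       Num.sqrt (derive1 (@complex.Re R \o c) t ^+ 2 +
                 derive1 (@complex.Im R \o c) t ^+ 2)).
Proof.
move=> du dv Dt.
have K0 : 0 <= 4 * delta ^+ 3 / Num.sqrt m *
      (Num.sqrt (sigma b (c t)) *
       Num.sqrt (derive1 (@complex.Re R \o c) t ^+ 2 +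
                 derive1 (@complex.Im R \o c) t ^+ 2)).
  by rewrite !mulr_ge0 ?invr_ge0 ?sqrtr_ge0 ?exprn_ge0// ltW.
have cc : {for t, continuous c}.
  by apply: cvg_Re_Im; [apply: (@differentiable_continuous _ _ _ t (@complex.Re R \o c))
     | apply: (@differentiable_continuous _ _ _ t (@complex.Im R \o c))];
    apply/derivable1_diffP.
have [dx|ndx] := pselect (dom a0 (par b (c t))); last first.
  exists 0; last by rewrite normr0.
  apply: (@near_eq_is_derive _ _ _ (cst 0)).
  have : (~` (par a0 @` [set z | nsq (z - z0) <= delta ^+ 2])) (par b (c t)).
    by move=> [z /disc_sub[Dz _] zE]; apply: ndx; rewrite -zE; exact: par_dom.
  move=> /(near_par cc Dt outside_open); apply: filterS => s [xP Ds].
  rewrite /bump; case: asboolP => // dxs.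
  rewrite max_l ?expr0n//= leNgt subr_gt0; apply/negP => sd.
  by apply: xP; exists (crd a0 (par b (c s))); [exact: ltW|exact: crdK].
have Tder : derivable (trans b a0) (c t) 1 by apply: trans_holomorphic.
have [d dN dle] := @is_derive_nsq_curve R (trans b a0) c t z0 Tder du dv.
set N := fun s => nsq (trans b a0 (c s) - z0) in dN.
exists (- (2 * Num.max 0 (delta ^+ 2 - N t) * d)).
  apply: (@near_eq_is_derive _ _ _
    ((fun y : R => Num.max 0 y ^+ 2) \o (fun s => delta ^+ 2 - N s))).
    have := near_par cc Dt (@dom_open _ X a0) dx; apply: filterS => s [dxs Ds].
    by rewrite /bump asboolT.
  have dI : is_derive (t : R^o) 1 (fun s => delta ^+ 2 - N s) (- d).
    have -> : (fun s => delta ^+ 2 - N s) = cst (delta ^+ 2) - N by [].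
    by apply: is_derive_eq; rewrite sub0r.
  have dO := is_derive_posq (delta ^+ 2 - N t).
  have := @is_derive1_comp R (fun y => Num.max 0 y ^+ 2)
    (fun s => delta ^+ 2 - N s) t _ _ dO dI.
  by rewrite mulrN.
have [h|h] := leP 0 (delta ^+ 2 - N t); last by rewrite mulr0 mul0r oppr0 normr0.
have Nd : N t <= delta ^+ 2 by rewrite -subr_ge0.
have [_ mle] := disc_sub Nd.
have ov : overlap b a0 (c t) by [].
rewrite (conformal_nsq ov); rewrite -/(jac b a0 (c t)) in dle.
set V := _ ^+ 2 + _ ^+ 2 in dle *; set J := nsq (jac _ _ _) in dle *.
have V0 : 0 <= V by rewrite addr_ge0 ?sqr_ge0.
have J0 : 0 <= J by exact: nsq_ge0.
have N0 : 0 <= N t by exact: nsq_ge0.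
have sm0 : 0 < Num.sqrt m by rewrite sqrtr_gt0.
have sg0 : 0 <= sigma a0 (trans b a0 (c t)) by rewrite (le_trans (ltW m0)).
rewrite normrN -sqrtrM ?mulr_ge0//.
rewrite [leRHS]mulrAC ler_pdivlMr//.
rewrite -[leLHS]ger0_norm ?mulr_ge0 ?sqrtr_ge0// -sqrtr_sqr.
have D3 : 0 <= 4 * delta ^+ 3 by rewrite mulr_ge0 ?exprn_ge0// ltW.
rewrite -[X in _ <= X * _](ger0_norm D3) -[X in _ <= X * _]sqrtr_sqr -sqrtrM ?sqr_ge0//.
apply: ler_wsqrtr.
rewrite exprMn real_normK ?num_real// (sqr_sqrtr (ltW m0)).
have d2 : (2 * (delta ^+ 2 - N t) * d) ^+ 2 <= (4 * delta ^+ 3) ^+ 2 * (J * V).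
  rewrite exprMn; apply: (le_trans (ler_wpM2l (sqr_ge0 _) dle)).
  rewrite [leLHS]mulrA; apply: ler_wpM2r; first by rewrite mulr_ge0.
  have -> : (4 * delta ^+ 3) ^+ 2 = 16 * delta ^+ 4 * delta ^+ 2 by ring.
  rewrite [leLHS]mulrA; apply: ler_pM => //; first by rewrite !mulr_ge0 ?sqr_ge0.
  have : (delta ^+ 2 - N t) ^+ 2 <= (delta ^+ 2) ^+ 2.
    by rewrite lerXn2r ?nnegrE ?sqr_ge0// gerBl.
  by rewrite -exprM !exprMn; lra.
apply: (le_trans (ler_wpM2r (ltW m0) d2)).
rewrite -mulrA ler_wpM2l ?sqr_ge0//.
have : m * (J * V) <= sigma a0 (trans b a0 (c t)) * (J * V).
  by rewrite ler_wpM2r ?mulr_ge0.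
by rewrite [_ * m]mulrC -[_ * J * V]mulrA.
Qed.


(** [K] times the running length, plus [bump], has nonnegative derivative along the arc by the
    fundamental theorem of calculus and [bump_derivable]; its values at 0 and 1 are compared. *)
Lemma arc_bump x y l : chart_arc sigma x y l ->
  bump x - bump y <= 4 * delta ^+ 3 / Num.sqrt m * l.
Proof.
move=> [b [c /=]]; set u := @complex.Re R \o c; set v := @complex.Im R \o c.
move=> [[duv [u'c v'c]] cD [-> ->] ->].
set f := fun t : R => Num.sqrt _ * Num.sqrt _; set K := 4 * _ / _.
have K0 : 0 <= K by rewrite !mulr_ge0 ?invr_ge0 ?sqrtr_ge0 ?exprn_ge0// ltW.
have [sm _ _] := sigma_conf.
have fc (t : R) : 0 <= t <= 1 -> {for t, continuous f}.
  move=> /cD Dt; have [du dv] := duv t.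
  have cc : {for t, continuous c}.
    by apply: cvg_Re_Im; [apply: (@differentiable_continuous _ _ _ t u)
       | apply: (@differentiable_continuous _ _ _ t v)]; apply/derivable1_diffP.
  apply: (@cvgM _ _ (nbhs t)).
    apply: (@cvg_comp _ _ _ (fun s => sigma b (c s)) Num.sqrt); last exact: sqrt_continuous.
    apply: (@cvg_comp _ _ _ c (sigma b) _ _ _ cc).
    by have [sc _] := sm b 0%N; exact: sc.
  apply: (@cvg_comp _ _ _ (fun s => derive1 u s ^+ 2 + derive1 v s ^+ 2) Num.sqrt);
    last exact: sqrt_continuous.
  apply: (@cvgD _ _ _ (nbhs t)).
    apply: (@cvg_comp _ _ _ (derive1 u) (fun x => x ^+ 2)); first exact: u'c.
    exact: exprn_continuous.
  apply: (@cvg_comp _ _ _ (derive1 v) (fun x => x ^+ 2)); first exact: v'c.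
  exact: exprn_continuous.
have fI : lebesgue_measure.-integrable `[0, 1] (EFin \o f).
  apply: continuous_compact_integrable; first exact: segment_compact.
  apply: continuous_in_subspaceT => t; rewrite inE /= in_itv /= => t01.
  exact: fc.
(* The running length, kept opaque behind the equation [FE]. *)
have [F FE] : {F : R -> R | F = fun t => Rintegral lebesgue_measure `[0, t] f}.
  by exists (fun t => Rintegral lebesgue_measure `[0, t] f).
have Fc : {within `[0, 1], continuous F}.
  by rewrite FE; exact: parameterized_integral_continuous.
have bd (t : R) : 0 <= t <= 1 ->
    exists2 d, is_derive (t : R^o) 1 (fun s => bump (par b (c s))) d &
      `|d| <= K * f t.
  by move=> /cD Dt; have [du dv] := duv t; exact: bump_derivable.
have bc : {within `[0, 1], continuous (fun s => bump (par b (c s)))}.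
  apply: derivable_within_continuous => t; rewrite in_itv /= => /bd[d [dd _] _].
  exact: dd.
have incr : {in `[0, 1] &, {homo (fun t : R => K * F t + bump (par b (c t))) : s t / s <= t}}.
  have Fd (t : R) : t \in `]0, 1[ ->
      is_derive (t : R^o) 1 (fun t => K * F t + bump (par b (c t)))
        (K * f t + derive1 (fun s => bump (par b (c s))) t) /\
      0 <= K * f t + derive1 (fun s => bump (par b (c s))) t.
    rewrite in_itv /= => /andP[t0 t1].
    have t01 : 0 <= t <= 1 by rewrite !ltW.
    have := continuous_FTC1_closed t1 fI t0 (fc t t01).
    rewrite /= -FE => -[dF F'].
    have dF' : is_derive (t : R^o) 1 F (f t).
      by apply: DeriveDef => //; rewrite -derive1E.
    have [d dd dle] := bd t t01.
    have -> : derive1 (fun s => bump (par b (c s))) t = d.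
      by rewrite derive1E; case: dd.
    split; last by move: dle; rewrite ler_norml => /andP[]; lra.
    have -> : (fun t => K * F t + bump (par b (c t))) =
      (K *: F) + (fun s => bump (par b (c s))) by [].
    by apply: is_derive_eq.
  apply: ger0_derive1_le_cc.
  - by move=> t /Fd[[dd _] _]; exact: dd.
  - by move=> t /Fd[[_ dE] H]; rewrite derive1E dE.
  - move=> t; apply: (@cvgD _ _ _ (nbhs t)); last exact: bc.
    by apply: cvgM; [exact: cvg_cst|exact: Fc].
have := incr 0 1; rewrite !in_itv /= !lexx ler01 => /(_ isT isT isT).
by rewrite FE /= set_itv1 Rintegral_set1 mulr0 add0r; lra.
Qed.

Lemma path_bump x y l : piecewise_path sigma x y l ->
  bump x - bump y <= 4 * delta ^+ 3 / Num.sqrt m * l.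
Proof.
elim=> [z|x' y' z l' m' arc _ IH]; first by rewrite subrr mulr0.
by have := arc_bump arc; rewrite mulrDr; lra.
Qed.

(** [bump] equals [delta^4] at [p] and drops by at most a constant times the length, so it is still
    positive at the end of any path shorter than the quotient. *)
Lemma metric_ball_sub_disc : exists2 r, 0 < r & forall x, metric_ball sigma p r x ->
  dom a0 x /\ nsq (crd a0 x - z0) < delta ^+ 2.
Proof.
have K0 : 0 < 4 * delta ^+ 3 / Num.sqrt m.
  by rewrite divr_gt0 ?sqrtr_gt0// mulr_gt0 ?exprn_gt0.
exists (delta ^+ 4 / (4 * delta ^+ 3 / Num.sqrt m)); first by rewrite divr_gt0 ?exprn_gt0.
move=> x /ereal_inf_lt[_ [l pl <-]]; rewrite lte_fin => lr.
apply: bump_gt0; have := path_bump pl; rewrite bump_center.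
have : 4 * delta ^+ 3 / Num.sqrt m * l < delta ^+ 4.
  by rewrite mulrC -ltr_pdivlMr.
lra.
Qed.

End MetricBall.

(** * Dependence on the parameter and change of chart *)

Section Assembly.
Variables (R : realType) (X : riemann_surface R).

Lemma Kpow_transition (L : sqrt_K X) (n : nat) (g : local_fun X R) a b z :
  hermitian_metric_Kpow L n g -> overlap a b z ->
  g b (trans a b z) = g a z * nsq (sq L a b z) ^+ n.
Proof.
move=> [_ _ gT] /gT; rewrite -exprnP -nsq_norm -rmorphM nsqX.
exact: complexI.
Qed.

(** By continuity at the centre: [M] exceeds the value of [|h|^2] there by 1, and [m] is half the
    value of [sigma]. *)
Lemma zero_of_order_nbhs (q : local_fun X R[i]) p k (sigma : local_fun X R) :
  zero_of_order q p k -> conformal_metric sigma ->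
  exists a, dom a p /\ exists rho M m : R, [/\ 0 < rho, 0 <= M, 0 < m &
    forall w, nsq (w - crd a p) <= rho ^+ 2 ->
      [/\ unit_disc w, m <= sigma a w &
          nsq (q a w) <= M * nsq (w - crd a p) ^+ k]].
Proof.
move=> [a [ap [h [_ hq]]]] [sm spos _]; exists a; split => //.
set z0 := crd a p in hq *.
have Dz0 : unit_disc z0 by exact: crd_disc.
have s0 := spos a z0 Dz0.
have [dh0 _] := nbhs_singleton hq.
have hc : {for z0, continuous h}.
  by apply: differentiable_continuous; apply/derivable1_diffP.
pose M := nsq (h z0) + 1; pose m := sigma a z0 / 2.
have hM : \forall w \near z0, nsq (h w) < M.
  have hc' := @cvg_comp _ _ _ h (@nsq R) _ _ _ hc (@continuous_nsq R (h z0)).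
  by apply: (cvgr_lt _ hc'); rewrite /M ltrDl.
have hm : \forall w \near z0, m < sigma a w.
  have [sc _] := sm a 0%N.
  by apply: (cvgr_gt _ (sc z0 Dz0)); rewrite /m; lra.
have hD := unit_disc_nbhs Dz0.
have : \forall w \near z0, [/\ unit_disc w, m <= sigma a w &
          nsq (q a w) <= M * nsq (w - z0) ^+ k].
  near=> w; split; first by near: w.
    by apply: ltW; near: w.
  have [_ ->] : derivable h w 1 /\ q a w = (w - z0) ^+ k * h w by near: w.
  rewrite nsqM nsqX mulrC ler_wpM2r ?exprn_ge0 ?nsq_ge0//.
  by apply: ltW; near: w.
move=> /nbhs_nsqP[rho rho0 hrho]; exists rho, M, m; split => //.
  by rewrite addr_ge0 ?nsq_ge0.
by rewrite divr_gt0.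
Unshelve. all: by end_near. Qed.

Lemma metric_ballS (sigma : local_fun X R) p r1 r2 : r1 <= r2 ->
  metric_ball sigma p r1 `<=` metric_ball sigma p r2.
Proof. by move=> r12 x; rewrite /metric_ball /= => /lt_le_trans; apply; rewrite lee_fin. Qed.

(** In the application [gw], [sw] are values in the fixed chart at [p], while [g], [sg] are those in
    an arbitrary chart; [l] is the squared modulus of the transition function of [K^(1/2)], and
    [e = s^(1/(k+4))]. Both [1 / g] and [sg^(n/2)] carry the factor [l^n], and [m <= sw] supplies
    the power of [sw]. *)
Lemma transfer_bound n (e C m rho A g gw sg sw l : R) :
  0 <= e -> 0 < g -> 0 < l -> 0 < m -> 0 < rho -> 0 <= A -> m <= sw ->
  gw = g * l ^+ n -> sg = sw * l ^+ 2 -> C = A / (rho * Num.sqrt m) ^+ n ->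
  gw^-1 <= A / (rho / e) ^+ n ->
  g^-1 <= C * (e ^+ n * Num.sqrt sg ^+ n).
Proof.
move=> e0 g0 l0 m0 rho0 A0 msw -> -> ->.
have sm0 : 0 < Num.sqrt m by rewrite sqrtr_gt0.
have ln : 0 < l ^+ n by rewrite exprn_gt0.
rewrite invfM ler_pdivrMr// => h; apply: (le_trans h).
rewrite sqrtrM ?(le_trans (ltW m0))// sqrtr_sqr (gtr0_norm l0).
rewrite expr_div_n invf_div !exprMn.
have smn : 0 < Num.sqrt m ^+ n by rewrite exprn_gt0.
have rn : 0 < rho ^+ n by rewrite exprn_gt0.
have sn : Num.sqrt m ^+ n <= Num.sqrt sw ^+ n.
  by rewrite lerXn2r ?nnegrE ?sqrtr_ge0// ler_wsqrtr.
have -> : A * (e ^+ n / rho ^+ n) * l ^+ n =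
  (A * e ^+ n / rho ^+ n * l ^+ n / Num.sqrt m ^+ n) * Num.sqrt m ^+ n.
  by field; rewrite !gt_eqF.
have -> : A / (rho ^+ n * Num.sqrt m ^+ n) *
     (e ^+ n * (Num.sqrt sw ^+ n * l ^+ n)) =
  (A * e ^+ n / rho ^+ n * l ^+ n / Num.sqrt m ^+ n) * Num.sqrt sw ^+ n.
  by field; rewrite !gt_eqF.
by rewrite ler_wpM2l// !mulr_ge0 ?invr_ge0 ?exprn_ge0// ltW.
Qed.

Lemma powR_root (s : R) (n j : nat) : 0 <= s ->
  s `^ (j%:R / n%:R) = (s `^ (1 / n%:R)) ^+ j.
Proof.
move=> s0; rewrite -powR_mulrn ?powR_ge0// -powRrM; congr (_ `^ _).
by rewrite mul1r mulrC.
Qed.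

End Assembly.

(** * The estimate near a zero of the quartic differential *)

Theorem theorem4 (R : realType) (X : riemann_surface R)
  (X_closed : closed_surface X) (X_genus : genus_at_least X 2)
  (L : sqrt_K X)
  (q0 : local_fun X R[i])
  (q0_hol : holomorphic_differential 4 q0) (q0_neq0 : nonzero_section q0)
  (sigma : local_fun X R) (sigma_hyp : hyperbolic_metric sigma)
  (g1 g2 : R -> local_fun X R)
  (g1_metric : forall s : R, 0 < s -> hermitian_metric_Kpow L 3 (g1 s))
  (g2_metric : forall s : R, 0 < s -> hermitian_metric_Kpow L 1 (g2 s))
  (g_harmonic : forall s : R, 0 < s ->
     harmonic_metric L (fun a z => s%:C * q0 a z) (diag_metric (g1 s) (g2 s)))
  (p : X) (k : nat) (k_ge1 : (1 <= k)%N) (p_zero : zero_of_order q0 p k) :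
  exists r : R -> R,
    [/\ forall s : R, 0 < s -> 0 < r s,
        r s @[s --> +oo] --> (0 : R),
        bigO_on_balls sigma p r
          (fun s a z => (g1 s a z)^-1)
          (fun s a z => s `^ (3 / (k%:R + 4)) * sigma a z `^ (3 / 2)) &
        bigO_on_balls sigma p r
          (fun s a z => (g2 s a z)^-1)
          (fun s a z => s `^ (1 / (k%:R + 4)) * sigma a z `^ (1 / 2))].
Proof.
have [_ _ X_hausdorff] := X_closed; have [sigma_conf _] := sigma_hyp.
have [_ sigma_pos _] := sigma_conf.
have [a0 [pa0 [rho0 [M [m [rho0_gt0 M0 m0 discP]]]]]] :=
  zero_of_order_nbhs p_zero sigma_conf.
pose z0 := crd a0 p.
pose e (s : R) := s `^ (1 / (k + 4)%:R).
have e_gt0 s : 0 < s -> 0 < e s by move=> ?; rewrite powR_gt0.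
have eX s : 0 < s -> e s ^+ (k + 4) = s.
  move=> s0; have k4 : (k + 4)%:R != 0 :> R by rewrite pnatr_eq0 addnS.
  by rewrite -powR_root ?divff// ?powRr1// ltW.
have e_ge1 s : 1 <= s -> 1 <= e s.
  by move=> s1; rewrite -(powRr0 s) ler_powR// divr_ge0.
(* At this scale [s rho^(k+4) = rho0^(k+4)] is independent of [s > 0]. *)
pose rho s := rho0 / e s.
have rho_gt0 s : 0 < s -> 0 < rho s by move=> /e_gt0 ?; rewrite divr_gt0.
have rho_le s : 1 <= s -> rho s <= rho0.
  move=> s1; have := e_ge1 s s1 => e1.
  by rewrite ler_pdivrMr ?ler_peMr ?(lt_le_trans ltr01 e1)// ltW.
have rho2_le s : 1 <= s -> rho s ^+ 2 <= rho0 ^+ 2.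
  move=> s1; have s0 := lt_le_trans ltr01 s1.
  by rewrite lerXn2r ?nnegrE ?rho_le// ltW// rho_gt0.
(* For [s >= 1] the ball is placed in the disc of radius [rho / 2], and the minimum with [1 / s]
   makes the radii tend to 0; for smaller [s] the value [1 / s] is a default. The condition [0 < s]
   stands under the existential so that choice yields a function on all of [R]. *)
have radius s : exists r, 0 < s -> [/\ 0 < r, r <= s^-1 &
    1 <= s -> forall x, metric_ball sigma p r x ->
      dom a0 x /\ nsq (crd a0 x - z0) < (rho s / 2) ^+ 2].
  have [s1|s1] := leP 1 s; last first.
    by exists s^-1 => s0; split; rewrite ?invr_gt0// leNgt s1.
  have s0 : 0 < s := lt_le_trans ltr01 s1.
  have d0 : 0 < rho s / 2 by rewrite divr_gt0 ?rho_gt0.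
  have disc_sub z : nsq (z - z0) <= (rho s / 2) ^+ 2 -> unit_disc z /\ m <= sigma a0 z.
    move=> zd; have [|//] := discP z.
    apply: (le_trans zd); apply: le_trans (rho2_le s s1).
    by rewrite expr_div_n; have := sqr_ge0 (rho s); lra.
  have [r r0 rball] := metric_ball_sub_disc sigma_conf X_hausdorff pa0 d0 m0 disc_sub.
  exists (Num.min r s^-1) => _; split.
  - by rewrite lt_min r0 invr_gt0.
  - by rewrite ge_min lexx orbT.
  - move=> _ x xb; apply: rball; apply: metric_ballS xb.
    by rewrite ge_min lexx.
have [r rP] := choice radius.
(* This is [s^2 M rho^(2k) rho^8] for every [s > 0], hence a uniform bound for [|s q0|^2 rho^8] on
   the disc when [s >= 1]. *)
pose K := M * rho0 ^+ (2 * (k + 4)).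
have K0 : 0 <= K by rewrite mulr_ge0 ?exprn_ge0// ltW.
have K4 : 0 < 4 + K by lra.
have est s : 1 <= s -> forall w, nsq (w - z0) <= (rho s / 2) ^+ 2 ->
    (g1 s a0 w)^-1 <= 3 * (4 + K) ^+ 2 / (rho s) ^+ 3 /\
    (g2 s a0 w)^-1 <= 2 * (4 + K) / rho s.
  move=> s1; have s0 : 0 < s := lt_le_trans ltr01 s1.
  have [sm1 pos1 _] := g1_metric s s0; have [sm2 pos2 _] := g2_metric s s0.
  have [_ hit] := g_harmonic s s0.
  have eqs w (Dw : unit_disc w) :=
    hitchin_scalar (sm1 a0 2%N) (sm2 a0 2%N) (pos1 a0) (pos2 a0) hit Dw.
  apply: (disc_estimate (N := fun w => nsq (s%:C * q0 a0 w)) (@unit_disc_open R)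
    (sm1 a0 2%N) (sm2 a0 2%N) (pos1 a0) (pos2 a0)) => //.
  - by move=> w /eqs[].
  - by move=> w /eqs[].
  - exact: rho_gt0.
  - by move=> w wd; have [|//] := discP w; exact: le_trans wd (rho2_le s s1).
  - move=> w wd; split; first exact: nsq_ge0.
    have [|_ _ qM] := discP w; first exact: le_trans wd (rho2_le s s1).
    have rs := rho_gt0 s s0.
    rewrite nsqM nsq_real.
    have h1 : nsq (q0 a0 w) <= M * (rho s ^+ 2) ^+ k.
      apply: (le_trans qM); rewrite ler_wpM2l// lerXn2r ?nnegrE ?nsq_ge0//.
      exact: sqr_ge0.
    have -> : K = s ^+ 2 * (M * (rho s ^+ 2) ^+ k) * rho s ^+ 8.
      have -> : s ^+ 2 * (M * (rho s ^+ 2) ^+ k) * rho s ^+ 8 =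
                M * (s * rho s ^+ (k + 4)) ^+ 2.
        rewrite [in RHS]exprMn -[in RHS]exprM mulnDl exprD mulnC exprM; ring.
      rewrite /rho expr_div_n (eX s s0) [s * _]mulrC divfK ?gt_eqF//.
      by rewrite -exprM mulnC.
    apply: ler_wpM2r; first by rewrite exprn_ge0// ltW.
    by rewrite ler_wpM2l ?sqr_ge0.
(* A point of the ball, given in any chart [a], is moved to the chart [a0], where [est] applies. *)
have local_bounds s a z : 1 <= s -> unit_disc z ->
    metric_ball sigma p (r s) (par a z) ->
    let w := trans a a0 z in let l := nsq (sq L a a0 z) in
    [/\ overlap a a0 z /\ m <= sigma a0 w,
      (g1 s a0 w)^-1 <= 3 * (4 + K) ^+ 2 / (rho s) ^+ 3 /\
      (g2 s a0 w)^-1 <= 2 * (4 + K) / (rho s) ^+ 1,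
      g1 s a0 w = g1 s a z * l ^+ 3, g2 s a0 w = g2 s a z * l ^+ 1 &
    [/\ 0 < g1 s a z /\ 0 < g2 s a z, 0 < l & sigma a z = sigma a0 w * l ^+ 2]].
  move=> s1 Dz zball w l; have s0 : 0 < s := lt_le_trans ltr01 s1.
  have [_ _ /(_ s1 _ zball)[xa0 wd]] := rP s s0.
  have ov : overlap a a0 z by [].
  have Dw : unit_disc w by exact: crd_disc.
  have [sm1 pos1 _] := g1_metric s s0; have [sm2 pos2 _] := g2_metric s s0.
  have g2T := Kpow_transition (n := 1) (g2_metric s s0) ov.
  have [_ mw _] : [/\ unit_disc w, m <= sigma a0 w &
      nsq (q0 a0 w) <= M * nsq (w - z0) ^+ k].
    apply: discP; apply: (le_trans (ltW wd)); apply: le_trans (rho2_le s s1).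
    by rewrite expr_div_n; have := sqr_ge0 (rho s); lra.
  (* If [l] were 0, the transition rule would make [g2] vanish in the chart [a0]. *)
  have l0 : 0 < l.
    rewrite lt_neqAle nsq_ge0 andbT; apply/eqP => l0.
    by have := pos2 a0 w Dw; rewrite g2T -/l -l0 expr1 mulr0 ltxx.
  split => //.
  - by rewrite expr1; apply: est => //; exact: ltW.
  - exact: (Kpow_transition (n := 3) (g1_metric s s0) ov).
  - split => //; first by split; [exact: pos1|exact: pos2].
    by rewrite (conformal_nsq sigma_conf ov) /l -nsqX (@sq_square _ _ L _ _ _ ov).
exists r; split.
- by move=> s /rP[].
- apply/cvgrPdist_lt => eps eps0; near=> s.
  have s0 : 0 < s by near: s; exact: nbhs_pinfty_gt.
  have [rs0 rs _] := rP s s0.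
  rewrite sub0r normrN gtr0_norm//; apply: (le_lt_trans rs).
  rewrite invf_plt ?posrE//; near: s; exact: (nbhs_pinfty_gt (num_real eps^-1)).
(* The constant is the [C] of [transfer_bound], here with exponent 3 and below with exponent 1. *)
- exists (3 * (4 + K) ^+ 2 / (rho0 * Num.sqrt m) ^+ 3), 1; split => //.
    by rewrite divr_gt0 ?mulr_gt0 ?exprn_gt0 ?mulr_gt0 ?sqrtr_gt0.
  move=> s s1 a z Dz zball; have s0 : 0 < s := lt_le_trans ltr01 s1.
  have [ov [bound _] g1T _ [[gz _] lpos sT]] := local_bounds s a z s1 Dz zball.
  have -> : s `^ (3 / (k%:R + 4)) = e s ^+ 3 by rewrite -natrD powR_root// ltW.
  have -> : sigma a z `^ (3 / 2) = Num.sqrt (sigma a z) ^+ 3.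
    by rewrite powR_root ?ltW ?sigma_pos// div1r powR12_sqrt// ltW// sigma_pos.
  have A0 : 0 <= 3 * (4 + K) ^+ 2 by rewrite mulr_ge0 ?sqr_ge0.
  exact: (transfer_bound (ltW (e_gt0 s s0)) gz lpos m0 rho0_gt0 A0 ov.2 g1T sT).
- exists (2 * (4 + K) / (rho0 * Num.sqrt m) ^+ 1), 1; split => //.
    by rewrite divr_gt0 ?exprn_gt0 ?mulr_gt0 ?sqrtr_gt0.
  move=> s s1 a z Dz zball; have s0 : 0 < s := lt_le_trans ltr01 s1.
  have [ov [_ bound] _ g2T [[_ gz] lpos sT]] := local_bounds s a z s1 Dz zball.
  have -> : s `^ (1 / (k%:R + 4)) = e s ^+ 1 by rewrite expr1 /e natrD.
  have -> : sigma a z `^ (1 / 2) = Num.sqrt (sigma a z) ^+ 1.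
    by rewrite expr1 div1r powR12_sqrt// ltW// sigma_pos.
  have A0 : 0 <= 2 * (4 + K) by rewrite mulr_ge0// ltW.
  exact: (transfer_bound (ltW (e_gt0 s s0)) gz lpos m0 rho0_gt0 A0 ov.2 g2T sT).
Unshelve. all: by end_near. Qed.
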